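(* Let $\lambda$ be a pole of $\mu$ or of $\nu$, and suppose $\lambda$ is not an eigenvalue of the boundary value problem (P) (defined in the context). Then the Green's function of (P) is given by $$G(x,t;\lambda)=\begin{cases} g^-(x,t;\lambda), & x,t\in[-a,0),\\ g^+(x,t;\lambda), & x,t\in(0,b],\\ 0, & (x,t)\in(0,b]\times[-a,0)\ \text{or}\ (x,t)\in[-a,0)\times(0,b],\end{cases}$$ in the sense that if $h\in L^2(-a,b)$ then $$g(x;\lambda)=\int_{-a}^b G(x,t;\lambda)h(t)\,dt$$ is a solution of $(\lambda-\ell)g=h$ on $(-a,0)$ and $(0,b)$ such that $g$ obeys the boundary conditions $g(-a)\cos\alpha=g'(-a)\sin\alpha$, $g(b)\cos\beta=g'(b)\sin\beta$ and the transmission conditions of (P) at $\lambda$. Here $g^-(x,t;\lambda)$ is the Green's function for the Sturm-Liouville equation $\ell y=\lambda y$ on $[-a,0]$ with boundary conditions $y(-a)\cos\alpha=y'(-a)\sin\alpha$ and $$y'(0^-)\nu(\lambda)=-y(0^-)\ \text{ if $\lambda$ is a pole of $\mu$ but not of $\nu$},\qquad y'(0^-)=0\ \text{ if $\lambda$ is a pole of $\nu$},$$ and $g^+(x,t;\lambda)$ is the Green's function for $\ell y=\lambda y$ on $[0,b]$ with boundary conditions $y(b)\cos\beta=y'(b)\sin\beta$ and $$y(0^+)\mu(\lambda)=y'(0^+)\ \text{ if $\lambda$ is a pole of $\nu$ but not of $\mu$},\qquad y(0^+)=0\ \text{ if $\lambda$ is a pole of $\mu$}.$$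
   Context: Let $a,b>0$, $q\in L^2(-a,b)$, $\alpha\in[0,\pi)$, $\beta\in(0,\pi]$, and $\ell y:=-y''+qy$. Let $N,M\in\mathbb{N}_0$ (empty sums are $0$), $\eta,\kappa\ge 0$, $\xi,\zeta\in\mathbb{R}$, real numbers $c_1<\dots<c_N$ and $d_1<\dots<d_M$, and $b_i>0$ ($i=1,\dots,N$), $a_j>0$ ($j=1,\dots,M$). Put $$\mu(\lambda)=-\Big(\lambda\eta-\xi-\sum_{i=1}^N\frac{b_i^2}{\lambda-c_i}\Big),\qquad \nu(\lambda)=\lambda\kappa+\zeta-\sum_{j=1}^M\frac{a_j^2}{\lambda-d_j}.$$ For a function $y$ on $(-a,0)\cup(0,b)$ write $y(0^\pm),y'(0^\pm)$ for one-sided limits at $0$, $\Delta y=y(0^+)-y(0^-)$, $\Delta' y=y'(0^+)-y'(0^-)$. Problem (P) with spectral parameter $\lambda\in\mathbb{C}$: $\ell y=\lambda y$ on $(-a,0)$ and on $(0,b)$, with $y,y',\ell y$ restricted to $(-a,0)$ in $L^2(-a,0)$ and restricted to $(0,b)$ in $L^2(0,b)$; boundary conditions $y(-a)\cos\alpha=y'(-a)\sin\alpha$ and $y(b)\cos\beta=y'(b)\sin\beta$; transmission conditions $y(0^+)\mu(\lambda)=\Delta' y$ and $y'(0^-)\nu(\lambda)=\Delta y$. If $\lambda$ is a pole of $\mu$, the first transmission condition is read as $y(0^+)=0$ (so that, if $\lambda$ is not a pole of $\nu$, the second becomes $y'(0^-)\nu(\lambda)=-y(0^-)$); if $\lambda$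 is a pole of $\nu$, the second is read as $y'(0^-)=0$ (so that, if $\lambda$ is not a pole of $\mu$, the first becomes $y(0^+)\mu(\lambda)=y'(0^+)$). $\lambda$ is an eigenvalue if (P) has a non-zero solution $y$. Sign convention: the Green's function $g^-$ of a problem on $[-a,0]$ is the kernel such that, for $h\in L^2(-a,0)$, $\int_{-a}^0 g^-(x,t;\lambda)h(t)\,dt$ is the solution of $(\lambda-\ell)g=h$ obeying the stated boundary conditions; similarly for $g^+$ on $[0,b]$. *)

(* Defs.v *)
From HB Require Import structures.
From mathcomp Require Import all_boot all_order all_algebra.
From mathcomp Require Export complex.
From mathcomp Require Import all_classical all_reals all_analysis.

Set Implicit Arguments.
Unset Strict Implicit.
Unset Printing Implicit Defensive.

Import Order.TTheory GRing.Theory Num.Theory.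
Import numFieldNormedType.Exports.

Local Open Scope classical_set_scope.
Local Open Scope ring_scope.
Local Open Scope complex_scope.

(* Limits, derivatives and integrals of functions R -> R[i] are taken on the
   real and imaginary parts, since the topology that MathComp-Analysis puts on
   R[i] makes it a normed module over itself and not over R. *)
Section ComplexValued.
Context {R : realType}.
Implicit Types (f : R -> R[i]) (F : set_system R) (x : R) (I : set R).

Definition reC f : R -> R := fun x => complex.Re (f x).
Definition imC f : R -> R := fun x => complex.Im (f x).

Definition cvgC F f : Prop := cvg (reC f @ F) /\ cvg (imC f @ F).
Definition limC F f : R[i] := lim (reC f @ F) +i* lim (imC f @ F).

Definition derivableC f x : Prop := derivable (reC f) x 1 /\ derivable (imC f) x 1.
Definition derivC f : R -> R[i] := fun x => derive1 (reC f) x +i* derive1 (imC f) x.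

Definition integrableC I f : Prop :=
  lebesgue_measure.-integrable I (EFin \o reC f) /\
  lebesgue_measure.-integrable I (EFin \o imC f).
Definition integralC I f : R[i] :=
  Rintegral lebesgue_measure I (reC f) +i* Rintegral lebesgue_measure I (imC f).

Definition L2 I f : Prop :=
  [/\ measurable_fun I (reC f), measurable_fun I (imC f) &
      (\int[lebesgue_measure]_(x in I) (Normc.normc (f x) ^+ 2)%:E < +oo)%E].

Definition abs_continuous (u v : R) f : Prop :=
  forall e : R, 0 < e -> exists2 d : R, 0 < d &
    forall (n : nat) (s t : 'I_n -> R),
      (forall i, u <= s i /\ s i <= t i /\ t i <= v) ->
      (forall i j, i != j -> t i <= s j \/ t j <= s i) ->
      \sum_(i < n) (t i - s i) < d ->
      \sum_(i < n) Normc.normc (f (t i) - f (s i)) < e.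

Definition loc_abs_continuous (l r : R) f : Prop :=
  forall u v, l < u -> u <= v -> v < r -> abs_continuous u v f.

(* |f z| tends to infinity as z tends to z0, for f meromorphic near z0; the
   value that f takes at z0 itself (where x / 0 = 0) is irrelevant. *)
Definition is_pole (f : R[i] -> R[i]) (z0 : R[i]) : Prop :=
  forall A : R, exists2 e : R, 0 < e &
    forall z, z != z0 -> Normc.normc (z - z0) < e -> A < Normc.normc (f z).

End ComplexValued.

Section TransferFunctions.
Context {R : realType}.

Definition mu (N : nat) (eta xi : R) (bb c : 'I_N -> R) (lam : R[i]) : R[i] :=
  - (lam * eta%:C - xi%:C - \sum_(i < N) (bb i ^+ 2)%:C / (lam - (c i)%:C)).

Definition nu (M : nat) (kappa zeta : R) (aa d : 'I_M -> R) (lam : R[i]) : R[i] :=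
  lam * kappa%:C + zeta%:C - \sum_(j < M) (aa j ^+ 2)%:C / (lam - (d j)%:C).

End TransferFunctions.

Section SturmLiouville.
Context {R : realType}.
Variable q : R -> R[i].
Implicit Types (h y w : R -> R[i]) (lam : R[i]).

(* [w] is a representative of y'', which is only defined almost everywhere. *)
Definition second_derivative (l r : R) y w : Prop :=
  [/\ forall x, x \in `]l, r[ -> derivableC y x,
      loc_abs_continuous l r (derivC y) &
      {ae lebesgue_measure, forall x, x \in `]l, r[ ->
         derivableC (derivC y) x /\ derivC (derivC y) x = w x}].

Definition ell y w : R -> R[i] := fun x => - w x + q x * y x.

(* (lam - ell) y = h on ]l, r[ with y, y', ell y in L^2(l, r).  These L^2
   conditions (with q in L^2) force y and y' to have one-sided limits at both
   endpoints; the existence of these limits is recorded explicitly because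
   [limC] is a total operator. *)
Definition sl_solution lam h (l r : R) y : Prop :=
  exists w : R -> R[i],
  [/\ second_derivative l r y w,
      L2 `]l, r[ y /\ L2 `]l, r[ (derivC y) /\ L2 `]l, r[ (ell y w),
      {ae lebesgue_measure, forall x, x \in `]l, r[ ->
         lam * y x - ell y w x = h x},
      cvgC l^'+ y /\ cvgC l^'+ (derivC y) &
      cvgC r^'- y /\ cvgC r^'- (derivC y)].

(* At an outer endpoint, y is required to take its one-sided limit as value. *)
Definition bc_left (a alpha : R) y : Prop :=
  y (- a) = limC (- a)^'+ y /\
  y (- a) * (cos alpha)%:C = limC (- a)^'+ (derivC y) * (sin alpha)%:C.

Definition bc_right (b beta : R) y : Prop :=
  y b = limC b^'- y /\
  y b * (cos beta)%:C = limC b^'- (derivC y) * (sin beta)%:C.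

Variables (a b alpha beta : R) (mu nu : R[i] -> R[i]).

Definition transmission lam y : Prop :=
  [/\ is_pole mu lam -> limC 0^'+ y = 0,
      ~ is_pole mu lam ->
        limC 0^'+ y * mu lam = limC 0^'+ (derivC y) - limC 0^'- (derivC y),
      is_pole nu lam -> limC 0^'- (derivC y) = 0 &
      ~ is_pole nu lam ->
        limC 0^'- (derivC y) * nu lam = limC 0^'+ y - limC 0^'- y].

Definition solution_P lam h y : Prop :=
  [/\ sl_solution lam h (- a) 0 y, sl_solution lam h 0 b y,
      bc_left a alpha y, bc_right b beta y & transmission lam y].

Definition eigenvalue_P lam : Prop :=
  exists y, solution_P lam (fun=> 0) y /\
    exists x, ((x \in `]- a, 0[) \/ (x \in `]0, b[)) /\ y x <> 0.

Definition solution_minus lam h y : Prop :=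
  [/\ sl_solution lam h (- a) 0 y, bc_left a alpha y,
      is_pole nu lam -> limC 0^'- (derivC y) = 0 &
      ~ is_pole nu lam -> limC 0^'- (derivC y) * nu lam = - limC 0^'- y].

Definition solution_plus lam h y : Prop :=
  [/\ sl_solution lam h 0 b y, bc_right b beta y,
      is_pole mu lam -> limC 0^'+ y = 0 &
      ~ is_pole mu lam -> limC 0^'+ y * mu lam = limC 0^'+ (derivC y)].

Definition kernel_op (D : set R) (K : R -> R -> R[i]) h : R -> R[i] :=
  fun x => integralC D (fun t => K x t * h t).

Definition green_minus lam (K : R -> R -> R[i]) : Prop :=
  forall h, L2 `]- a, 0[ h ->
  [/\ forall x, x \in `[- a, 0[ -> integrableC `]- a, 0[ (fun t => K x t * h t),
      solution_minus lam h (kernel_op `]- a, 0[ K h) &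
      forall y, solution_minus lam h y ->
        forall x, x \in `[- a, 0[ -> y x = kernel_op `]- a, 0[ K h x].

Definition green_plus lam (K : R -> R -> R[i]) : Prop :=
  forall h, L2 `]0, b[ h ->
  [/\ forall x, x \in `]0, b] -> integrableC `]0, b[ (fun t => K x t * h t),
      solution_plus lam h (kernel_op `]0, b[ K h) &
      forall y, solution_plus lam h y ->
        forall x, x \in `]0, b] -> y x = kernel_op `]0, b[ K h x].

Definition green_P (gm gp : R -> R -> R[i]) (x t : R) : R[i] :=
  if (x \in `[- a, 0[) && (t \in `[- a, 0[) then gm x t
  else if (x \in `]0, b]) && (t \in `]0, b]) then gp x t
  else 0.

End SturmLiouville.

(* Main.v *)
Require Import Defs.
From mathcomp Require Import all_boot all_order all_algebra complex.
From mathcomp Require Import all_classical all_reals all_analysis.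
From mathcomp Require Import measurable_realfun.
From mathcomp Require Import ring lra.
Import Order.TTheory GRing.Theory Num.Theory.
Import numFieldNormedType.Exports.
Local Open Scope classical_set_scope.
Local Open Scope ring_scope.
Local Open Scope complex_scope.

(** At a pole of mu or nu the problem (P) falls apart. A pole of mu turns the
    first transmission condition into y(0+) = 0, after which the second one
    involves only y(0-) and y'(0-); a pole of nu turns the second condition
    into y'(0-) = 0, after which the first involves only y(0+) and y'(0+).
    So (P) is a pair of independent regular Sturm-Liouville problems, one on
    ]-a, 0[ and one on ]0, b[, and its Green's function is block diagonal.

    If one of these two homogeneous problems had a nontrivial solution, its
    extension by zero across 0 would be an eigenfunction of (P)
    ([left_problem_trivial], [right_problem_trivial]). As lam is not an
    eigenvalue, both have only the trivial solution. This gives uniqueness for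
    the inhomogeneous problems, by subtraction. It also gives existence
    ([green_kernel_exists]): let u solve the homogeneous equation with the
    left boundary condition and v with the right one; their Wronskian W is
    constant, and it is nonzero because otherwise u would satisfy both
    conditions; then u(min(x, t)) v(max(x, t)) / W is a Green's function, by
    variation of constants. The two kernels are put together in
    [green_P_solution].

    Since q is merely square integrable, the equation holds almost everywhere
    and y' is only absolutely continuous. Every function constructed below is
    a primitive F(x) = C + int_{-oo}^x f of a function f integrable on the
    whole line ([primitive]): the equation on ]l, r[ is multiplied by the
    indicator of ]l, r[, so that solutions are constant to the left of l and to
    the right of r, and one-sided limits at the endpoints become values of
    continuous functions. Three facts about primitives carry the analysis.
    - The Leibniz rule [primitiveM], proved by Fubini. It yields the constancy
      of the Wronskian, the variation of constants formula, and the powers of a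
      primitive that bound Picard iterates.
    - Existence for linear systems with integrable coefficients
      ([linear_system_exists]), by Picard iteration.
    - The passage from integral equations to solutions in the sense of the
      problem ([sl_solution_of_primitives]), by the Lebesgue differentiation
      theorem and the absolute continuity of the integral. *)

(** * Primitives of integrable functions on the line *)

Section RealPrimitive.
Set Implicit Arguments.
Unset Strict Implicit.
Context {R : realType}.
Notation leb := (@lebesgue_measure R).
Implicit Types (f g F G : R -> R) (x C : R).

Definition summable_fun f : Prop := leb.-integrable setT (EFin \o f).

(** Integrating from -oo avoids choosing a base point: restrictions to
    intervals enter through the integrand. *)
Definition cumul f x : R := \int[leb]_(t in `]-oo, x]) f t.

(** A function is recorded together with its density rather than
    differentiated almost everywhere. [C] is the value at -oo; for a density
    that vanishes to the left of l it is the initial value at l. *)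
Definition primitive C F f : Prop :=
  summable_fun f /\ forall x, F x = C + cumul f x.

Lemma summable_measurable f : summable_fun f -> measurable_fun setT f.
Proof. by move=> /integrableP[/measurable_EFinP]. Qed.

Lemma eq_summable f g : f =1 g -> summable_fun f -> summable_fun g.
Proof. by move=> /funext ->. Qed.

Lemma summable0 : summable_fun (fun=> 0).
Proof. exact: integrable0. Qed.

Lemma summableD f g :
  summable_fun f -> summable_fun g -> summable_fun (fun x => f x + g x).
Proof. by move=> sf sg; exact: (integrableD measurableT sf sg). Qed.

Lemma summableZ k f : summable_fun f -> summable_fun (fun x => k * f x).
Proof. by move=> sf; exact: (integrableZl measurableT k sf). Qed.

Lemma summableN f : summable_fun f -> summable_fun (fun x => - f x).
Proof.
by move=> /(summableZ (-1)); apply: eq_summable => x; rewrite mulN1r.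
Qed.

Lemma summableB f g :
  summable_fun f -> summable_fun g -> summable_fun (fun x => f x - g x).
Proof. by move=> sf /summableN; exact: summableD. Qed.

Lemma summable_sum (I : Type) (s : seq I) (f : I -> R -> R) :
  (forall i, summable_fun (f i)) -> summable_fun (fun x => \sum_(i <- s) f i x).
Proof.
move=> sf; elim: s => [|i s ih].
  by apply: eq_summable summable0 => x; rewrite big_nil.
by apply: eq_summable (summableD (sf i) ih) => x; rewrite big_cons.
Qed.

Lemma summable_norm f : summable_fun f -> summable_fun (fun x => `|f x|).
Proof. exact: integrable_norm. Qed.

Lemma summable_le f g : measurable_fun setT f -> summable_fun g ->
  (forall x, `|f x| <= g x) -> summable_fun f.
Proof.
move=> mf sg fg; apply: (le_integrable measurableT _ _ sg).
  exact/measurable_EFinP.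
by move=> x _ /=; rewrite lee_fin (le_trans (fg x))// ler_norm.
Qed.

Lemma summableM_bounded f g B : summable_fun f -> measurable_fun setT g ->
  (forall x, `|g x| <= B) -> summable_fun (fun x => f x * g x).
Proof.
move=> sf mg gB; apply: (@summable_le _ (fun x => B * `|f x|)).
- by apply: measurable_funM => //; exact: summable_measurable.
- by apply: summableZ; exact: summable_norm.
- by move=> x; rewrite normrM mulrC ler_wpM2r.
Qed.

Lemma summable_restrict A f : measurable A -> summable_fun f ->
  leb.-integrable A (EFin \o f).
Proof. by move=> mA; exact: integrableS. Qed.

Lemma summable_patch A f : measurable A -> leb.-integrable A (EFin \o f) ->
  summable_fun (f \_ A).
Proof.
by move=> mA; rewrite /summable_fun (integrable_mkcond _ mA)// restrict_EFin.
Qed.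

Lemma cumulD f g x : summable_fun f -> summable_fun g ->
  cumul (fun t => f t + g t) x = cumul f x + cumul g x.
Proof. by move=> sf sg; rewrite /cumul RintegralD//; exact: summable_restrict. Qed.

Lemma cumulB f g x : summable_fun f -> summable_fun g ->
  cumul (fun t => f t - g t) x = cumul f x - cumul g x.
Proof. by move=> sf sg; rewrite /cumul RintegralB//; exact: summable_restrict. Qed.

Lemma cumulZ k f x : summable_fun f -> cumul (fun t => k * f t) x = k * cumul f x.
Proof. by move=> sf; rewrite /cumul RintegralZl//; exact: summable_restrict. Qed.

Lemma le_cumul f g x : summable_fun f -> summable_fun g ->
  (forall t, f t <= g t) -> cumul f x <= cumul g x.
Proof. by move=> sf sg fg; apply: le_Rintegral => //; exact: summable_restrict. Qed.

Lemma cumul_norm_le f x : summable_fun f ->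
  `|cumul f x| <= cumul (fun t => `|f t|) x.
Proof. by move=> sf; apply: le_normr_Rintegral => //; exact: summable_restrict. Qed.

Lemma cumul_ge0 f x : (forall t, 0 <= f t) -> 0 <= cumul f x.
Proof. by move=> f0; apply: Rintegral_ge0. Qed.

Lemma cumul_incr f x y : summable_fun f -> x <= y ->
  cumul f y - cumul f x = \int[leb]_(t in `]x, y]) f t.
Proof.
move=> sf xy; rewrite /cumul Rintegral_itvB//.
exact: summable_restrict.
Qed.

Lemma cumul_le_total f x : summable_fun f -> (forall t, 0 <= f t) ->
  cumul f x <= \int[leb]_t f t.
Proof.
move=> sf f0; rewrite /cumul Rintegral_mkcond.
apply: le_Rintegral => //.
  by apply: summable_patch => //; exact: summable_restrict.
by move=> t _; rewrite patchE; case: ifP.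
Qed.

Lemma cumul_bounded f x : summable_fun f ->
  `|cumul f x| <= \int[leb]_t `|f t|.
Proof.
move=> sf; apply: (le_trans (cumul_norm_le _ sf)).
by apply: cumul_le_total => //; exact: summable_norm.
Qed.

(** By absolute continuity of the integral, an increment over a short
    interval is small. *)
Lemma cumul_continuous f : summable_fun f -> continuous (cumul f).
Proof.
move=> sf x; apply/cvgrPdist_lt => e e0.
have [d [d0 dP]] := integral_normr_continuous sf e0.
have key u v : u <= v -> v - u < d -> `|cumul f v - cumul f u| < e.
  move=> uv vud; rewrite cumul_incr//.
  apply: (le_lt_trans (le_normr_Rintegral _ _)) => //.
    exact: summable_restrict.
  have : (leb `]u, v] < d%:E)%E.
    rewrite lebesgue_measure_itv/= lte_fin.
    by case: ifPn => // _; rewrite -EFinD lte_fin.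
  exact: dP.
near=> y; have xy : `|x - y| < d by near: y; exact: cvgr_dist_lt.
have [le|/ltW le] := leP x y.
  by rewrite distrC; apply: key => //; apply: le_lt_trans xy; rewrite distrC ler_norm.
by apply: key => //; apply: le_lt_trans xy; rewrite ler_norm.
Unshelve. all: by end_near. Qed.

Lemma primitive_continuous C F f : primitive C F f -> continuous F.
Proof.
move=> [sf FE]; have -> : F = fun x => C + cumul f x by exact/funext.
by move=> x; apply: cvgD; [exact: cvg_cst|exact: cumul_continuous].
Qed.

Lemma primitive_bounded C F f : primitive C F f -> exists B, forall x, `|F x| <= B.
Proof.
move=> [sf FE]; exists (`|C| + \int[leb]_t `|f t|) => x; rewrite FE.
by apply: (le_trans (ler_normD _ _)); rewrite lerD2l cumul_bounded.
Qed.

Lemma primitive_measurable C F f : primitive C F f -> measurable_fun setT F.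
Proof. by move=> /primitive_continuous; exact: continuous_measurable_fun. Qed.

Lemma summableM_primitive C F f g : primitive C F f -> summable_fun g ->
  summable_fun (fun x => g x * F x).
Proof.
move=> pF sg; have [B FB] := primitive_bounded pF.
exact: (summableM_bounded sg (primitive_measurable pF) FB).
Qed.

End RealPrimitive.

(** * The Leibniz rule for primitives *)

Section ProductRule.
Set Implicit Arguments.
Unset Strict Implicit.
Context {R : realType}.
Notation leb := (@lebesgue_measure R).
Implicit Types (f g F G : R -> R) (x C D : R).

(** f(s) g(t) on the half plane s < t, the function to which Fubini is
    applied in the integration by parts. *)
Let below (f g : R -> R) (z : R * R) : R := if z.1 < z.2 then f z.1 * g z.2 else 0.

Let measurable_below f g :
  measurable_fun setT f -> measurable_fun setT g -> measurable_fun setT (below f g).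
Proof.
move=> mf mg; apply: measurable_fun_ifT.
- by apply: measurable_fun_ltr; [exact: measurable_fst|exact: measurable_snd].
- by apply: measurable_funM; apply: measurableT_comp.
- exact: measurable_cst.
Qed.

(** By Tonelli: the inner integral is at most |f(s)| times the L^1 norm of
    [g]. *)
Let integrable_below f g : summable_fun f -> summable_fun g ->
  (leb \x leb)%E.-integrable setT (EFin \o below f g).
Proof.
move=> sf sg; apply/integrable12ltyP.
  by apply/measurable_EFinP; apply: measurable_below; exact: summable_measurable.
have ifg : leb.-integrable setT
    (EFin \o (fun s => `|f s| * \int[leb]_t `|g t|)).
  apply: (@eq_summable _ (fun s => (\int[leb]_t `|g t|) * `|f s|)).
    by move=> s; rewrite mulrC.
  by apply: summableZ; exact: summable_norm.
apply: le_lt_trans (integrable_lty measurableT ifg).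
apply: ge0_le_integral => //=.
- by move=> s _; exact: integral_ge0.
- apply: (@measurable_fun_fubini_tonelli_F _ _ _ _ _ leb (abse \o (EFin \o below f g))) => [|z]; last exact: abse_ge0.
  apply: measurableT_comp => //.
  by apply/measurable_EFinP; apply: measurable_below; exact: summable_measurable.
- exact: measurable_int ifg.
move=> s _.
have sg' : leb.-integrable setT (EFin \o (fun t => `|f s| * `|g t|)).
  by apply: summableZ; exact: summable_norm.
have mfg : measurable_fun [set: R] (fun t => below f g (s, t)).
  apply: (@measurable_fun_ifT _ _ _ _ (fun t => f s * g t) (fun=> 0) (fun t => s < t)).
  - exact: measurable_fun_ltr.
  - by apply: measurable_funM => //; exact: summable_measurable.
  - exact: measurable_cst.
rewrite -RintegralZl//; last exact: summable_norm.
rewrite /Rintegral fineK; last exact: integrable_fin_num.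
apply: ge0_le_integral => //=.
- exact/measurable_EFinP/measurableT_comp.
- exact: measurable_int sg'.
move=> t _; rewrite lee_fin /below/=; case: ifP => _; first by rewrite normrM.
by rewrite normr0 mulr_ge0.
Qed.

Let section_gt g s : summable_fun g ->
  \int[leb]_t (if s < t then g t else 0) = \int[leb]_t g t - cumul g s.
Proof.
move=> sg; rewrite /cumul [X in _ - X]Rintegral_mkcond -RintegralB//; last first.
  by apply: summable_patch => //; exact: summable_restrict.
apply: eq_Rintegral => t _; rewrite patchE.
have [st|ts] := ltP s t; case: ifPn => //.
- by rewrite inE/= in_itv/= leNgt st.
- by rewrite subr0.
- by rewrite subrr.
- by rewrite notin_setE/= in_itv/= => /negP; rewrite ts.
Qed.

Let section_lt f t : summable_fun f ->
  \int[leb]_s (if s < t then f s else 0) = cumul f t.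
Proof.
move=> sf; rewrite /cumul -Rintegral_itv_bndo_bndc; last exact: summable_restrict.
rewrite [RHS]Rintegral_mkcond.
apply: eq_Rintegral => s _; rewrite patchE.
have [st|ts] := ltP s t; case: ifPn => //.
- by rewrite notin_setE/= in_itv/= => /negP; rewrite st.
- by rewrite inE/= in_itv/= ltNge ts.
Qed.

Let summable_sect f (P : pred R) : measurable [set x | P x] ->
  summable_fun f -> summable_fun (fun x => if P x then f x else 0).
Proof.
move=> mP sf; have := summable_patch mP (summable_restrict mP sf).
by apply: eq_summable => x; rewrite patchE; congr (if _ then _ else _); apply/idP/idP; rewrite inE.
Qed.

Lemma cumul_primitive f : summable_fun f -> primitive 0 (cumul f) f.
Proof. by move=> sf; split=> // x; rewrite add0r. Qed.

(** Split the product of the two integrals, seen as a double integral,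
    along the diagonal. The part t <= s integrates to int f (cumul g) by
    definition; the part s < t integrates to int (cumul f) g after exchanging
    the order of integration. *)
Let Rintegral_prod f g : summable_fun f -> summable_fun g ->
  (\int[leb]_t f t) * (\int[leb]_t g t) =
  \int[leb]_t (f t * cumul g t + cumul f t * g t).
Proof.
move=> sf sg.
have sfg : summable_fun (fun t => f t * cumul g t).
  exact: summableM_primitive (cumul_primitive sg) sf.
have sgf : summable_fun (fun t => cumul f t * g t).
  have := summableM_primitive (cumul_primitive sf) sg.
  by apply: eq_summable => x; rewrite mulrC.
(* Both inner integrals have closed forms: the tail of g, and cumul f. *)
have := Fubini (integrable_below sf sg).
under eq_integral => s _.
  rewrite (_ : (\int[leb]_y _)%E = (f s * (\int[leb]_t g t - cumul g s))%:E); last first.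
    have ss : summable_fun (fun t => if s < t then g t else 0).
      by apply: summable_sect => //; rewrite -set_itvoy.
    rewrite -section_gt// -RintegralZl// /Rintegral fineK; last first.
      by apply: integrable_fin_num => //; exact: summableZ.
    by apply: eq_integral => t _; rewrite /below/=; case: ifP; rewrite ?mulr0.
  over.
under [X in _ = X -> _]eq_integral => t _.
  rewrite (_ : (\int[leb]_y _)%E = (cumul f t * g t)%:E); last first.
    have ss : summable_fun (fun s => if s < t then f s else 0).
      by apply: summable_sect => //; rewrite -set_itvNyo.
    rewrite -section_lt// mulrC -RintegralZl// /Rintegral fineK; last first.
      by apply: integrable_fin_num => //; exact: summableZ.
    by apply: eq_integral => s _; rewrite /below/=; case: ifP; rewrite ?mulr0// mulrC.
  over.
move=> /(congr1 fine); rewrite -!/(Rintegral _ _ _).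
rewrite RintegralD// => <-.
have sfB : summable_fun (fun s => f s * (\int[leb]_t g t - cumul g s)).
  have := summableB (summableZ (\int[leb]_t g t) sf) sfg.
  by apply: eq_summable => s; rewrite mulrBr [X in X - _]mulrC.
rewrite -RintegralD//.
rewrite -[LHS]RintegralZr//; apply: eq_Rintegral => s _.
by rewrite mulrBr addrC subrK.
Qed.

(** Cutting both densities at x reduces this to the product of two integrals
    over the line. *)
Lemma cumulM f g x : summable_fun f -> summable_fun g ->
  cumul f x * cumul g x = cumul (fun t => f t * cumul g t + cumul f t * g t) x.
Proof.
move=> sf sg; set I := `]-oo, x]%classic.
have mI : measurable I by exact: measurable_itv.
have cut h : summable_fun h -> summable_fun (h \_ I).
  by move=> sh; apply: summable_patch => //; exact: summable_restrict.
have cumul_cut h t : t <= x -> cumul (h \_ I) t = cumul h t.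
  move=> tx; apply: eq_Rintegral => s; rewrite inE/= in_itv/= => st.
  by rewrite patchE mem_set// /I/= in_itv/= (le_trans st).
have := Rintegral_prod (cut _ sf) (cut _ sg).
rewrite -!Rintegral_mkcond -/(cumul f x) -/(cumul g x) => ->.
rewrite [RHS]/cumul [RHS]Rintegral_mkcond; apply: eq_Rintegral => t _.
rewrite !patchE; case: ifPn; last by rewrite mul0r mulr0 addr0.
by rewrite inE /I/= in_itv/= => tx; rewrite !cumul_cut.
Qed.

(** Integration by parts for functions that are differentiable only through
    their densities: expand the constants and apply [cumulM]. *)
Lemma primitiveM C F f D G g : primitive C F f -> primitive D G g ->
  primitive (C * D) (fun x => F x * G x) (fun x => f x * G x + F x * g x).
Proof.
move=> pF pG; have [sf FE] := pF; have [sg GE] := pG.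
have sfG := summableM_primitive pG sf.
have sFg : summable_fun (fun x => F x * g x).
  have := summableM_primitive pF sg.
  by apply: eq_summable => x; rewrite mulrC.
split; first exact: summableD.
move=> x.
have sfcg := summableM_primitive (cumul_primitive sg) sf.
have scfg : summable_fun (fun t => cumul f t * g t).
  have := summableM_primitive (cumul_primitive sf) sg.
  by apply: eq_summable => t; rewrite mulrC.
transitivity (C * D + (cumul (fun t => D * f t) x + cumul (fun t => C * g t) x
   + cumul (fun t => f t * cumul g t + cumul f t * g t) x)).
  by rewrite FE GE -cumulM// !cumulZ//; ring.
have sDf := summableZ D sf; have sCg := summableZ C sg.
congr (_ + _); rewrite -(cumulD _ sDf sCg) -cumulD; last 2 first.
- exact: summableD.
- exact: summableD.
by congr cumul; apply/funext => t; rewrite FE GE; ring.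
Qed.

Lemma primitiveD C F f D G g : primitive C F f -> primitive D G g ->
  primitive (C + D) (fun x => F x + G x) (fun x => f x + g x).
Proof.
move=> [sf FE] [sg GE]; split; first exact: summableD.
by move=> x; rewrite FE GE cumulD//; ring.
Qed.

Lemma primitiveB C F f D G g : primitive C F f -> primitive D G g ->
  primitive (C - D) (fun x => F x - G x) (fun x => f x - g x).
Proof.
move=> [sf FE] [sg GE]; split; first exact: summableB.
by move=> x; rewrite FE GE cumulB//; ring.
Qed.

(** The primitive must vanish at -oo, so that all its powers do. With the
    cumulated norm of the coefficients for [F], these are the iterated integrals
    that produce the factorials in Picard's estimate. *)
Lemma primitive_expr F f n : primitive 0 F f ->
  primitive 0 (fun x => F x ^+ n.+1) (fun x => n.+1%:R * (F x ^+ n * f x)).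
Proof.
move=> pF; elim: n => [|n ih].
  by under [X in primitive _ _ X]eq_fun do rewrite expr0 !mul1r.
have := primitiveM pF ih; rewrite mulr0.
congr (primitive _ _ _); apply/funext => x /=.
by rewrite exprS -[n.+2]addn1 natrD; ring.
Qed.

End ProductRule.

(** * Linear systems with integrable coefficients *)

Section LinearSystem.
Set Implicit Arguments.
Unset Strict Implicit.
Context {R : realType}.
Notation leb := (@lebesgue_measure R).

Lemma cumul_dominated_cvg (f_ : nat -> R -> R) (f g : R -> R) (x : R) :
  (forall n, measurable_fun setT (f_ n)) ->
  (forall t, f_ ^~ t @ \oo --> f t) ->
  summable_fun g -> (forall n t, `|f_ n t| <= g t) ->
  summable_fun f /\ (fun n => cumul (f_ n) x) @ \oo --> cumul f x.
Proof.
move=> mf_ f_f sg fg.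
have mf : measurable_fun setT f.
  by apply: (measurable_fun_cvg mf_) => t _; exact: f_f.
have f_le t : `|f t| <= g t.
  have cn : (fun n => `|f_ n t|) @ \oo --> `|f t| by apply: cvg_norm; exact: f_f.
  rewrite -(cvg_lim _ cn)//; apply: limr_le; first by apply/cvg_ex; exists (`|f t|).
  by apply: nearW => n; exact: fg.
have sf : summable_fun f := summable_le mf sg f_le.
have sf_ n : summable_fun (f_ n) := summable_le (mf_ n) sg (fg n).
split=> //.
set I := `]-oo, x]%classic; have mI : measurable I by exact: measurable_itv.
have [||||| _ _] := @dominated_convergence _ _ _ leb I mI
  (fun n t => (f_ n t)%:E) (fun t => (f t)%:E) (fun t => (g t)%:E).
- by move=> n; apply/measurable_EFinP; apply: measurable_funTS (mf_ n).
- by apply/measurable_EFinP; apply: measurable_funTS mf.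
- by apply: aeW => t _; apply/fine_cvgP; split; [exact: nearW|exact: f_f].
- exact: summable_restrict.
- by apply: aeW => t n _; rewrite lee_fin.
have fin h : summable_fun h -> (\int[leb]_(t in I) (h t)%:E)%E \is a fin_num.
  by move=> sh; apply: integrable_fin_num => //; exact: summable_restrict.
by rewrite -(fineK (fin _ sf)) => /fine_cvgP[].
Qed.

Variables (n : nat) (A : 'I_n -> 'I_n -> R -> R) (c : 'I_n -> R).
Hypothesis sA : forall i j, summable_fun (A i j).

(** The terms of the Neumann series: the solution is the sum over [k] of
    these iterated integrals, starting from the constant initial value. *)
Fixpoint picard_term (k : nat) : 'I_n -> R -> R :=
  if k is k'.+1 then
    fun i => cumul (fun t => \sum_(j < n) A i j t * picard_term k' j t)
  else fun i _ => c i.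

(** A single integrable function that dominates every row of the
    coefficient matrix. *)
Let weight (t : R) : R := \sum_(i < n) \sum_(j < n) `|A i j t|.
Let size0 : R := \sum_(i < n) `|c i|.
Let total : R := \int[leb]_t weight t.

Let sw : summable_fun weight.
Proof.
by apply: summable_sum => i; apply: summable_sum => j; exact: summable_norm.
Qed.

Let w0 t : 0 <= weight t.
Proof. by apply: sumr_ge0 => i _; apply: sumr_ge0. Qed.

Let size0_ge0 : 0 <= size0. Proof. exact: sumr_ge0. Qed.

Let row_le i t : \sum_(j < n) `|A i j t| <= weight t.
Proof.
by rewrite /weight [leRHS](bigD1 i)//= lerDl sumr_ge0// => j _; apply: sumr_ge0.
Qed.

Let cw0 x : 0 <= cumul weight x. Proof. exact: cumul_ge0. Qed.

Let cw_total x : cumul weight x <= total. Proof. exact: cumul_le_total. Qed.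

Lemma picard_term_primitive k i : exists C f, primitive C (picard_term k i) f.
Proof.
elim: k i => [|k ih] i.
  exists (c i), (fun=> 0); split; first exact: summable0.
  by move=> x /=; rewrite /cumul Rintegral_cst// mul0r addr0.
exists 0, (fun t => \sum_(j < n) A i j t * picard_term k j t).
apply: cumul_primitive; apply: summable_sum => j.
by have [C [f pf]] := ih j; exact: summableM_primitive pf (sA i j).
Qed.

Let summable_term k i :
  summable_fun (fun t => \sum_(j < n) A i j t * picard_term k j t).
Proof.
apply: summable_sum => j.
by have [C [f pf]] := picard_term_primitive k j; exact: summableM_primitive pf (sA i j).
Qed.

(** Induction on [k]: bounding the [k]-th term in the integrand leaves
    weight * (cumul weight)^k / k!, whose integral is
    (cumul weight)^(k+1) / (k+1)! by [primitive_expr]. *)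
Lemma picard_term_le k i x :
  `|picard_term k i x| <= size0 * (cumul weight x ^+ k / k`!%:R).
Proof.
elim: k i x => [|k ih] i x.
  rewrite /= expr0 fact0 divr1 mulr1 /size0 (bigD1 i)//= lerDl.
  exact: sumr_ge0.
have pw := primitive_expr k (cumul_primitive sw).
have [sp pE] := pw.
have sg : summable_fun (fun t => size0 / k.+1`!%:R *
    (k.+1%:R * (cumul weight t ^+ k * weight t))) by exact: summableZ.
rewrite /= (le_trans (cumul_norm_le _ (summable_term k i)))//.
rewrite (_ : size0 * _ = size0 / k.+1`!%:R * cumul weight x ^+ k.+1); last first.
  by rewrite mulrAC mulrA.
rewrite pE add0r -cumulZ//; apply: le_cumul => //.
  exact/summable_norm/summable_term.
move=> t; apply: (le_trans (ler_norm_sum _ _ _)).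
rewrite factS natrM invfM.
rewrite [leRHS](_ : _ = weight t * (size0 * (cumul weight t ^+ k / k`!%:R))); last first.
  by field; rewrite nat1r !pnatr_eq0 -lt0n fact_gt0.
apply: (@le_trans _ _ (\sum_(j < n) `|A i j t| * (size0 * (cumul weight t ^+ k / k`!%:R)))).
  by apply: ler_sum => j _; rewrite normrM ler_wpM2l.
rewrite -mulr_suml ler_wpM2r// mulr_ge0// divr_ge0// exprn_ge0//.
Qed.

Let bound_term k i x : `|picard_term k i x| <= size0 * exp_coeff total k.
Proof.
apply: (le_trans (picard_term_le _ _ _)).
rewrite ler_wpM2l// /exp_coeff/= ler_wpM2r// lerXn2r// nnegrE//.
exact: le_trans (cw0 x) (cw_total x).
Qed.

Let total_ge0 : 0 <= total. Proof. exact: le_trans (cw0 0) (cw_total 0). Qed.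

(** Partial sums of the Neumann series. They are bounded, uniformly in [k] and
    in the point, by a multiple of the exponential of the total weight. *)
Let partial k i x : R := \sum_(0 <= l < k) picard_term l i x.

Let partial_cvg i x : cvgn (fun k => partial k i x).
Proof.
apply: normed_cvg.
apply: (@series_le_cvg _ _ (fun k => size0 * exp_coeff total k)).
- by move=> k /=; exact: normr_ge0.
- by move=> k /=; rewrite mulr_ge0// divr_ge0// exprn_ge0.
- by move=> k; exact: bound_term.
- exact/is_cvg_seriesZ/is_cvg_series_exp_coeff.
Qed.

Let partial_le k i x : `|partial k i x| <= size0 * expR total.
Proof.
apply: (le_trans (ler_norm_sum _ _ _)).
apply: (@le_trans _ _ (\sum_(0 <= l < k) size0 * exp_coeff total l)).
  by apply: ler_sum => l _; exact: bound_term.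
rewrite -mulr_sumr ler_wpM2l//.
apply: (@nondecreasing_cvgn_le _ (series (exp_coeff total))) => //.
  apply/nondecreasing_seqP => l.
  by rewrite /series/= big_nat_recr//= lerDl divr_ge0// exprn_ge0.
exact: is_cvg_series_exp_coeff.
Qed.

(** The partial sums are exactly the Picard iterates, so that the integral
    equation is obtained by letting [k] tend to infinity on both sides. *)
Let partialS k i x :
  partial k.+1 i x = c i + cumul (fun t => \sum_(j < n) A i j t * partial k j t) x.
Proof.
rewrite /partial big_nat_recl//=; congr (_ + _).
elim: k => [|k ih].
  rewrite big_geq// (_ : (fun _ => _) = fun=> 0); last first.
    by apply/funext => t; apply: big1 => j _; rewrite big_geq// mulr0.
  by rewrite /cumul Rintegral_cst// mul0r.
rewrite big_nat_recr//= ih -cumulD//; last first.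
  apply: summable_sum => j; under eq_fun do rewrite mulr_sumr.
  apply: summable_sum => l.
  by have [C [f pf]] := picard_term_primitive l j; exact: summableM_primitive pf (sA i j).
congr cumul; apply/funext => t; rewrite -big_split/=.
by apply: eq_bigr => j _; rewrite big_nat_recr//= mulrDr.
Qed.

Let measurable_partial k i : measurable_fun setT (partial k i).
Proof.
apply: measurable_sum => l.
by have [C [f pf]] := picard_term_primitive l i; exact: primitive_measurable pf.
Qed.

(** The bound on [picard_term] makes the Neumann series converge pointwise
    and dominates its partial sums, so that dominated convergence passes to the
    limit in [partialS]. *)
Theorem linear_system_exists : exists Y : 'I_n -> R -> R, forall i,
  primitive (c i) (Y i) (fun t => \sum_(j < n) A i j t * Y j t).
Proof.
pose Y i x := limn (fun k => partial k i x); exists Y => i.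
have YP j x : (fun k => partial k j x) @ \oo --> Y j x by exact: partial_cvg.
pose F k t := \sum_(j < n) A i j t * partial k j t.
pose g t := weight t * (size0 * expR total).
have key x : summable_fun (fun t => \sum_(j < n) A i j t * Y j t) /\
    (fun k => cumul (F k) x) @ \oo --> cumul (fun t => \sum_(j < n) A i j t * Y j t) x.
  apply: (@cumul_dominated_cvg _ _ g).
  - move=> k; apply: measurable_sum => j; apply: measurable_funM => //.
    exact: summable_measurable.
  - by move=> t; apply: cvg_big => [|j _]; [exact: add_continuous|apply: cvgMr; exact: YP].
  - have := summableZ (size0 * expR total) sw.
    by apply: eq_summable => t; rewrite mulrC.
  - move=> k t; apply: (le_trans (ler_norm_sum _ _ _)).
    apply: (@le_trans _ _ (\sum_(j < n) `|A i j t| * (size0 * expR total))).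
      by apply: ler_sum => j _; rewrite normrM ler_wpM2l.
    by rewrite -mulr_suml ler_wpM2r// mulr_ge0// expR_ge0.
split; first by have [] := key 0.
move=> x; have [_ lim2] := key x.
have lim1 : (fun k => partial k.+1 i x) @ \oo --> Y i x.
  by have := YP i x; rewrite -(cvg_shiftS (fun k => partial k i x)).
have lim3 : (fun k => partial k.+1 i x) @ \oo -->
    c i + cumul (fun t => \sum_(j < n) A i j t * Y j t) x.
  rewrite (_ : (fun k => _) = fun k => c i + cumul (F k) x); last first.
    by apply/funext => k; exact: partialS.
  by apply: cvgD => //; exact: cvg_cst.
exact: cvg_unique lim1 lim3.
Qed.

End LinearSystem.

(** * Differentiability and absolute continuity of primitives *)

Section Differentiation.
Set Implicit Arguments.
Unset Strict Implicit.
Context {R : realType}.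
Notation leb := (@lebesgue_measure R).
Implicit Types (f F : R -> R) (x C : R).

Lemma primitiveE C F f : primitive C F f -> F = (fun x => C + cumul f x).
Proof. by move=> [_ FE]; exact/funext. Qed.

Let derivable_shift C f x : derivable (cumul f) x 1 ->
  derivable (fun t => C + cumul f t) x 1 /\
  derive1 (fun t => C + cumul f t) x = derive1 (cumul f) x.
Proof.
move=> df; split; first by apply: derivableD => //; exact: derivable_cst.
rewrite !derive1E (_ : (fun t => _) = cst C + cumul f) //.
by rewrite deriveD// derive_cst add0r.
Qed.

(** Needed because the problem asks y itself to be differentiable at every
    point, which holds since its density y' is continuous. *)
Lemma primitive_derivable_continuous C F f x : primitive C F f ->
  {for x, continuous f} -> derivable F x 1 /\ derive1 F x = f x.
Proof.
move=> pF cf; rewrite (primitiveE pF); have [sf _] := pF.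
have xx1 : x < x + 1 by rewrite ltrDl.
have sf1 : leb.-integrable [set` Interval -oo%O (BRight (x + 1))] (EFin \o f).
  exact: summable_restrict.
have [df dfE] := continuous_FTC1 xx1 sf1 (ltNyr _) cf.
by have [? ->] := derivable_shift C df.
Qed.

Lemma primitive_derivable_ae C F f : primitive C F f ->
  {ae leb, forall x, derivable F x 1 /\ derive1 F x = f x}.
Proof.
move=> pF; rewrite (primitiveE pF); have [sf _] := pF.
have locf : locally_integrable setT f.
  have := integrable_locally measurableT sf.
  by rewrite patch_setT.
have int y : leb.-integrable `]-oo, y] (EFin \o f) by exact: summable_restrict.
have := FTC1Ny int locf; apply: filterS; first exact: (ae_filter_ringOfSetsType leb).
move=> x [df dfE].
by have [? ->] := derivable_shift C df.
Qed.

(** Absolute continuity of the integral, applied to the union of the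
    intervals: disjointness makes both the measure of the union and the
    integral over it additive. *)
Lemma sum_norm_increments f (e : R) : summable_fun f -> 0 < e ->
  exists2 d : R, 0 < d & forall (n : nat) (s t : 'I_n -> R),
    (forall i, s i <= t i) ->
    (forall i j, i != j -> t i <= s j \/ t j <= s i) ->
    \sum_(i < n) (t i - s i) < d ->
    \sum_(i < n) (cumul (fun x => `|f x|) (t i) - cumul (fun x => `|f x|) (s i)) < e.
Proof.
move=> sf e0; have [d [d0 dP]] := integral_normr_continuous sf e0.
exists d => // n s t st disj std.
pose E (i : 'I_n) := `]s i, t i]%classic.
pose D := \big[setU/set0]_(i <- enum 'I_n) E i.
have mE i : measurable (E i) by exact: measurable_itv.
have mD : measurable D by apply: bigsetU_measurable.
have trE : trivIset [set` enum 'I_n] E.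
  move=> i j _ _ [x []]; rewrite /E/= !in_itv/= => /andP[six xti] /andP[sjx xtj].
  apply/eqP/negPn/negP => /disj[ts|ts].
    by have := le_lt_trans ts sjx; rewrite ltNge xti.
  by have := le_lt_trans ts six; rewrite ltNge xtj.
have snf := summable_norm sf.
have lebE i : leb (E i) = (t i - s i)%:E.
  rewrite /E lebesgue_measure_itv/= lte_fin.
  have := st i; rewrite le_eqVlt => /predU1P[->|->].
    by rewrite ltxx subrr.
  by rewrite -EFinD.
have lebD : (leb D < d%:E)%E.
  rewrite /D big_enum/= measure_bigsetU_ord//; last first.
    by apply: sub_trivIset trE => i _; rewrite /= mem_enum.
  rewrite (eq_bigr (fun i => (t i - s i)%:E)); last by move=> i _; exact: lebE.
  by rewrite sumEFin lte_fin.
have := dP _ mD lebD; apply: le_lt_trans.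
under eq_bigr do rewrite cumul_incr//.
rewrite -lee_fin {2}/Rintegral fineK; last first.
  by apply: integrable_fin_num => //; exact: summable_restrict.
rewrite /D integral_bigsetU_EFin//=.
- rewrite big_enum/= -sumEFin; apply: lee_sum => i _.
  by rewrite /Rintegral fineK//; apply: integrable_fin_num => //; exact: summable_restrict.
- exact: enum_uniq.
- apply/measurable_EFinP; apply: measurable_funTS; exact: summable_measurable snf.
Qed.

End Differentiation.

(** * Complex-valued primitives *)

Section ComplexPrimitive.
Set Implicit Arguments.
Unset Strict Implicit.
Context {R : realType}.
Notation leb := (@lebesgue_measure R).
Notation Re := complex.Re.
Notation Im := complex.Im.
Implicit Types (f g F G : R -> R[i]) (x : R) (C D : R[i]).

Lemma eq_Re_Im (z w : R[i]) : Re z = Re w -> Im z = Im w -> z = w.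
Proof. by case: z w => [a b] [c d] /= -> ->. Qed.

Lemma ReD (z w : R[i]) : Re (z + w) = Re z + Re w. Proof. by case: z w => [? ?] []. Qed.
Lemma ImD (z w : R[i]) : Im (z + w) = Im z + Im w. Proof. by case: z w => [? ?] []. Qed.
Lemma ReN (z : R[i]) : Re (- z) = - Re z. Proof. by case: z. Qed.
Lemma ImN (z : R[i]) : Im (- z) = - Im z. Proof. by case: z. Qed.
Lemma ReM (z w : R[i]) : Re (z * w) = Re z * Re w - Im z * Im w.
Proof. by case: z w => [? ?] []. Qed.
Lemma ImM (z w : R[i]) : Im (z * w) = Re z * Im w + Im z * Re w.
Proof. by case: z w => [? ?] []. Qed.

Definition ReImE := (ReD, ImD, ReN, ImN, ReM, ImM).

Lemma normc_sqr (z : R[i]) : Normc.normc z ^+ 2 = Re z ^+ 2 + Im z ^+ 2.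
Proof. by case: z => a b /=; rewrite sqr_sqrtr// addr_ge0// sqr_ge0. Qed.

Lemma normc_ge0 (z : R[i]) : 0 <= Normc.normc z.
Proof. by case: z => a b /=; exact: sqrtr_ge0. Qed.

Lemma normc_le (z : R[i]) : Normc.normc z <= `|Re z| + `|Im z|.
Proof.
rewrite -(ler_pXn2r (ltn0Sn 1)) ?nnegrE ?normc_ge0 ?addr_ge0//.
rewrite normc_sqr sqrrD !real_normK ?num_real// [leRHS]addrAC lerDl.
by rewrite mulrn_wge0// mulr_ge0.
Qed.

(** Limits and integrals are taken on real and imaginary parts, so a complex
    primitive is a pair of real ones. *)
Definition primitiveC C F f : Prop :=
  primitive (Re C) (reC F) (reC f) /\ primitive (Im C) (imC F) (imC f).

Lemma eq_primitiveC C F f g : f =1 g -> primitiveC C F f -> primitiveC C F g.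
Proof. by move=> /funext ->. Qed.

Lemma primitiveCD C F f D G g : primitiveC C F f -> primitiveC D G g ->
  primitiveC (C + D) (fun x => F x + G x) (fun x => f x + g x).
Proof.
move=> [rF iF] [rG iG]; split; [have := primitiveD rF rG|have := primitiveD iF iG];
  by congr (primitive _ _ _); rewrite ?ReImE//; apply/funext => x;
     rewrite /reC /imC ReImE.
Qed.

Lemma primitiveCM C F f D G g : primitiveC C F f -> primitiveC D G g ->
  primitiveC (C * D) (fun x => F x * G x) (fun x => f x * G x + F x * g x).
Proof.
move=> [rF iF] [rG iG]; split.
  have := primitiveB (primitiveM rF rG) (primitiveM iF iG).
  by congr (primitive _ _ _); rewrite ?ReImE//; apply/funext => x;
     rewrite /reC /imC !ReImE//; ring.
have := primitiveD (primitiveM rF iG) (primitiveM iF rG).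
by congr (primitive _ _ _); rewrite ?ReImE//; apply/funext => x;
   rewrite /reC /imC !ReImE//; ring.
Qed.

Lemma primitiveC_cst C : primitiveC C (fun=> C) (fun=> 0).
Proof.
by split; (split; first exact: summable0) => x; rewrite /cumul Rintegral_cst// mul0r addr0.
Qed.

Lemma primitiveCZ k C F f : primitiveC C F f ->
  primitiveC (k * C) (fun x => k * F x) (fun x => k * f x).
Proof.
move=> pF; have := primitiveCM (primitiveC_cst k) pF.
by apply: eq_primitiveC => x; rewrite mul0r add0r.
Qed.

Lemma primitiveCB C F f D G g : primitiveC C F f -> primitiveC D G g ->
  primitiveC (C - D) (fun x => F x - G x) (fun x => f x - g x).
Proof.
move=> pF /(primitiveCZ (-1)) pG; have := primitiveCD pF pG.
by rewrite mulN1r; congr (primitiveC _ _ _); apply/funext => x; rewrite mulN1r.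
Qed.

(** This replaces the statement that a function with zero derivative
    is constant, which fails for derivatives that exist only almost
    everywhere. *)
Lemma primitiveC0_cst C F : primitiveC C F (fun=> 0) -> forall x, F x = C.
Proof.
move=> [[_ rE] [_ iE]] x.
have c0 : cumul (fun=> 0) x = 0 :> R by rewrite /cumul Rintegral_cst// mul0r.
by apply: eq_Re_Im; [rewrite -[LHS]/(reC F x) rE|rewrite -[LHS]/(imC F x) iE];
  rewrite c0 addr0.
Qed.

Lemma primitiveC_init C F f x : primitiveC C F f ->
  (forall t, t <= x -> f t = 0) -> F x = C.
Proof.
move=> [[sr rE] [si iE]] f0.
have key (h : R -> R) : (forall t, t <= x -> h t = 0) -> cumul h x = 0.
  move=> h0; rewrite /cumul (@eq_Rintegral _ _ _ leb _ (fun=> 0)) ?Rintegral_cst ?mul0r//.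
  by move=> t; rewrite inE/= in_itv/=; exact: h0.
apply: eq_Re_Im; [rewrite -[LHS]/(reC F x) rE|rewrite -[LHS]/(imC F x) iE];
  by rewrite key ?addr0// => t /f0 ft; rewrite /reC/imC ft.
Qed.

Lemma primitiveC_cvg (K : set_system R) C F f x : Filter K -> primitiveC C F f ->
  K --> x -> reC F @ K --> Re (F x) /\ imC F @ K --> Im (F x).
Proof.
move=> FK [rF iF] Kx; split.
  have cF := primitive_continuous rF.
  exact: cvg_trans (cvg_app (reC F) Kx) (cF x).
have cF := primitive_continuous iF.
exact: cvg_trans (cvg_app (imC F) Kx) (cF x).
Qed.

Lemma primitiveC_abs_continuous C F f u v :
  primitiveC C F f -> abs_continuous u v F.
Proof.
move=> [[sr rE] [si iE]] e e0.
have e20 : 0 < e / 2 by rewrite divr_gt0.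
have [d1 d10 d1P] := sum_norm_increments sr e20.
have [d2 d20 d2P] := sum_norm_increments si e20.
exists (Order.min d1 d2); first by rewrite lt_min d10.
move=> n s t ust disj; rewrite lt_min => /andP[std1 std2].
have st i : s i <= t i by have [_ []] := ust i.
have := ltrD (d1P n s t st disj std1) (d2P n s t st disj std2).
rewrite -splitr; apply: le_lt_trans; rewrite -big_split/=; apply: ler_sum => i _.
have key (C' : R) (H h : R -> R) : summable_fun h -> (forall x, H x = C' + cumul h x) ->
    `|H (t i) - H (s i)| <=
    cumul (fun x => `|h x|) (t i) - cumul (fun x => `|h x|) (s i).
  move=> sh HE; rewrite !HE opprD addrACA subrr add0r !cumul_incr//; last exact: summable_norm.
  by apply: le_normr_Rintegral => //; exact: summable_restrict.
apply: (le_trans (normc_le _)); rewrite !ReImE.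
by apply: lerD; [exact: key rE|exact: key iE].
Qed.

End ComplexPrimitive.

Section ComplexSystem.
Set Implicit Arguments.
Unset Strict Implicit.
Context {R : realType}.

(** The first order system y' = e p, p' = Q y has four real unknowns, the real
    and imaginary parts of y and p, to which [linear_system_exists] applies. *)
Lemma second_order_exists (e : R -> R) (Q : R -> R[i]) (c d : R[i]) :
  summable_fun e -> summable_fun (reC Q) -> summable_fun (imC Q) ->
  exists y p : R -> R[i],
    primitiveC c y (fun x => (e x)%:C * p x) /\ primitiveC d p (fun x => Q x * y x).
Proof.
move=> se srQ siQ.
(* The unknowns are numbered Re y, Im y, Re p, Im p. *)
pose A (i j : 'I_4) : R -> R :=
  match nat_of_ord i, nat_of_ord j with
  | 0, 2 | 1, 3 => e
  | 2, 0 | 3, 1 => reC Q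
  | 2, 1 => fun x => (- imC Q x)%R
  | 3, 0 => imC Q
  | _, _ => fun=> 0%R
  end%N.
pose c0 (i : 'I_4) : R := match nat_of_ord i with
  | 0 => complex.Re c | 1 => complex.Im c | 2 => complex.Re d | _ => complex.Im d end%N.
have sA i j : summable_fun (A i j).
  case: i => -[|[|[|[|//]]]] ?; case: j => -[|[|[|[|//]]]] ?; rewrite /A/= //;
  by [exact: summable0|exact: summableN].
have [Y YP] := linear_system_exists c0 sA.
pose i0 : 'I_4 := @Ordinal 4 0 isT.
pose i1 : 'I_4 := @Ordinal 4 1 isT.
pose i2 : 'I_4 := @Ordinal 4 2 isT.
pose i3 : 'I_4 := @Ordinal 4 3 isT.
have sumE (f : 'I_4 -> R) : \sum_i f i = f i0 + f i1 + f i2 + f i3.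
  by rewrite !big_ord_recr big_ord0/= add0r; do 3?congr (_ + _); congr f; exact: val_inj.
exists (fun x => Y i0 x +i* Y i1 x), (fun x => Y i2 x +i* Y i3 x).
have H i f : (forall x, \sum_j A i j x * Y j x = f x) -> primitive (c0 i) (Y i) f.
  by move=> /funext <-; exact: YP.
split; split.
- by apply: (H i0) => x; rewrite sumE /A /reC /= ?ReM/=; ring.
- by apply: (H i1) => x; rewrite sumE /A /imC /= ?ImM/=; ring.
- by apply: (H i2) => x; rewrite sumE /A /reC /= ?ReM/= /imC; ring.
- by apply: (H i3) => x; rewrite sumE /A /imC /= ?ImM/= /reC; ring.
Qed.

End ComplexSystem.

(** * Functions on an open interval *)

Section OpenInterval.
Set Implicit Arguments.
Unset Strict Implicit.
Context {R : realType}.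
Notation leb := (@lebesgue_measure R).
Notation derivC := Defs.derivC.
Implicit Types (f g y h w : R -> R[i]) (l r x : R).

(** Everything that the problem says about a function on ]l, r[, one-sided
    limits at l and r included, depends only on its values there. The values at
    the endpoints are therefore free, and solutions may be modified or extended
    outside. *)
Definition eq_oo l r f g : Prop := forall x, x \in `]l, r[ -> f x = g x.

Lemma eq_oo_sym l r f g : eq_oo l r f g -> eq_oo l r g f.
Proof. by move=> fg x /fg. Qed.

Let eq_oo_part l r f g x : eq_oo l r f g -> x \in `]l, r[ ->
  (\near x, reC f x = reC g x) /\ (\near x, imC f x = imC g x).
Proof.
move=> fg xlr; split; near=> t; rewrite /reC /imC fg//;
  by near: t; exact: near_in_itvoo.
Unshelve. all: by end_near. Qed.

Lemma eq_oo_derivableC l r f g x : eq_oo l r f g -> x \in `]l, r[ ->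
  derivableC f x -> derivableC g x.
Proof.
move=> fg xlr [df di]; have [rfg ifg] := eq_oo_part fg xlr.
by split; [apply: near_eq_derivable df|apply: near_eq_derivable di].
Qed.

Lemma eq_oo_derivC l r f g : eq_oo l r f g -> eq_oo l r (derivC f) (derivC g).
Proof.
move=> fg x xlr; have [rfg ifg] := eq_oo_part fg xlr.
by rewrite /derivC !derive1E; congr (_ +i* _); exact: near_eq_derive.
Qed.

Lemma limCP (K : set_system R) f (a b : R) : ProperFilter K ->
  reC f @ K --> a -> imC f @ K --> b -> cvgC K f /\ limC K f = a +i* b.
Proof.
move=> PK fa fb; split; first by split; [apply/cvg_ex; exists a|apply/cvg_ex; exists b].
by rewrite /limC (cvg_lim _ fa)// (cvg_lim _ fb).
Qed.

Lemma cvgCP (K : set_system R) f : ProperFilter K -> cvgC K f ->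
  reC f @ K --> complex.Re (limC K f) /\ imC f @ K --> complex.Im (limC K f).
Proof. by move=> PK [cr ci]. Qed.

Lemma near_eq_limC (K : set_system R) f g : ProperFilter K ->
  (\forall x \near K, f x = g x) -> cvgC K f -> cvgC K g /\ limC K g = limC K f.
Proof.
move=> PK fg /cvgCP[fa fb].
have := @limCP K g (complex.Re (limC K f)) (complex.Im (limC K f)) PK; apply.
  by apply: cvg_trans fa; apply: near_eq_cvg; apply: filterS fg => x; rewrite /reC => ->.
by apply: cvg_trans fb; apply: near_eq_cvg; apply: filterS fg => x; rewrite /imC => ->.
Qed.

Lemma near_right_oo l r : l < r -> \forall x \near l^'+, x \in `]l, r[.
Proof.
move=> lr; near=> x; rewrite in_itv/=; apply/andP; split; near: x.
  exact: nbhs_right_gt.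
exact: nbhs_right_lt.
Unshelve. all: by end_near. Qed.

Lemma near_left_oo l r : l < r -> \forall x \near r^'-, x \in `]l, r[.
Proof.
move=> lr; near=> x; rewrite in_itv/=; apply/andP; split; near: x.
  exact: nbhs_left_gt.
exact: nbhs_left_lt.
Unshelve. all: by end_near. Qed.

Lemma eq_oo_limC_left l r f g : l < r -> eq_oo l r f g -> cvgC l^'+ f ->
  cvgC l^'+ g /\ limC l^'+ g = limC l^'+ f.
Proof.
by move=> lr fg; apply: near_eq_limC; apply: filterS (near_right_oo lr) => x /fg.
Qed.

Lemma eq_oo_limC_right l r f g : l < r -> eq_oo l r f g -> cvgC r^'- f ->
  cvgC r^'- g /\ limC r^'- g = limC r^'- f.
Proof.
by move=> lr fg; apply: near_eq_limC; apply: filterS (near_left_oo lr) => x /fg.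
Qed.

Lemma eq_L2 (I : set R) f g : {in I, f =1 g} -> L2 I f -> L2 I g.
Proof.
move=> fg [mr mi fin]; split.
- by apply: eq_measurable_fun mr => x /fg; rewrite /reC => ->.
- by apply: eq_measurable_fun mi => x /fg; rewrite /imC => ->.
- rewrite (_ : (\int[leb]_(x in I) _)%E =
      (\int[leb]_(x in I) (Normc.normc (f x) ^+ 2)%:E)%E)//.
  by apply: eq_integral => x /fg ->.
Qed.

Lemma eq_oo_L2 l r f g : eq_oo l r f g -> L2 `]l, r[ f -> L2 `]l, r[ g.
Proof. by move=> fg; apply: eq_L2 => x; rewrite inE; exact: fg. Qed.

Lemma eq_oo_loc_abs_continuous l r f g : eq_oo l r f g ->
  loc_abs_continuous l r f -> loc_abs_continuous l r g.
Proof.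
move=> fg cf u v lu uv vr e e0; have [d d0 dP] := cf u v lu uv vr e e0.
exists d => // n s t ust disj std; apply: le_lt_trans (dP n s t ust disj std).
apply: ler_sum => i _; have [us [st tv]] := ust i.
rewrite !fg// in_itv/=.
  by rewrite (lt_le_trans lu us) (le_lt_trans (le_trans st tv) vr).
by rewrite (lt_le_trans lu (le_trans us st)) (le_lt_trans tv vr).
Qed.

Lemma eq_oo_sl_solution (q : R -> R[i]) lam h1 h2 l r y1 y2 : l < r ->
  eq_oo l r y1 y2 -> eq_oo l r h1 h2 ->
  sl_solution q lam h1 l r y1 -> sl_solution q lam h2 l r y2.
Proof.
move=> lr y12 h12 [w [[dy ac aew] [Ly [Lp Le]] aeq [cl cpl] [cr cpr]]].
have p12 := eq_oo_derivC y12.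
exists w; split.
- split.
  + by move=> x xlr; apply: (eq_oo_derivableC y12 xlr); exact: dy.
  + exact: eq_oo_loc_abs_continuous ac.
  + apply: filterS aew; first exact: (ae_filter_ringOfSetsType leb).
    move=> x xw xlr; have [dp dpw] := xw xlr.
    split; first exact: (eq_oo_derivableC p12 xlr dp).
    by rewrite -dpw -(eq_oo_derivC p12).
- split; first exact: eq_oo_L2 Ly.
  split; first exact: eq_oo_L2 Lp.
  by apply: eq_oo_L2 Le => x xlr; rewrite /ell y12.
- apply: filterS aeq; first exact: (ae_filter_ringOfSetsType leb).
  by move=> x xh xlr; rewrite -h12// -xh// /ell y12.
- by split; [have [] := eq_oo_limC_left lr y12 cl|have [] := eq_oo_limC_left lr p12 cpl].
- by split; [have [] := eq_oo_limC_right lr y12 cr|have [] := eq_oo_limC_right lr p12 cpr].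
Qed.

End OpenInterval.

(** * Square integrable functions *)

Section SquareIntegrable.
Set Implicit Arguments.
Unset Strict Implicit.
Context {R : realType}.
Notation leb := (@lebesgue_measure R).
Notation normc := Normc.normc.
Implicit Types (f g : R -> R[i]) (D E : set (measurableTypeR R)).

Lemma normc_sqr_fun f :
  (fun x => normc (f x) ^+ 2) = (fun x => reC f x ^+ 2 + imC f x ^+ 2).
Proof. by apply/funext => x; rewrite normc_sqr. Qed.

Lemma L2P D f : measurable D -> L2 D f <->
  [/\ measurable_fun D (reC f), measurable_fun D (imC f) &
      leb.-integrable D (EFin \o (fun x => normc (f x) ^+ 2))].
Proof.
move=> mD; split=> -[mr mi fin]; split => //.
  apply/integrableP; split; last first.
    under eq_integral => x _.
      rewrite /= ger0_norm ?sqr_ge0//.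
      over.
    exact: fin.
  apply/measurable_EFinP; rewrite normc_sqr_fun.
  by apply: measurable_funD; exact: measurable_funX.
move/integrableP : fin => [_]; apply: le_lt_trans.
by rewrite le_eqVlt; apply/orP; left; apply/eqP/eq_integral => x _; rewrite /= ger0_norm ?sqr_ge0.
Qed.

Lemma L2S D E f : measurable D -> measurable E -> E `<=` D -> L2 D f -> L2 E f.
Proof.
move=> mD mE ED /(L2P _ mD)[mr mi fin]; apply/(L2P _ mE); split.
- exact: measurable_funS mr.
- exact: measurable_funS mi.
- exact: integrableS fin.
Qed.

Lemma L2D D f g : measurable D -> L2 D f -> L2 D g -> L2 D (fun x => f x + g x).
Proof.
move=> mD /(L2P _ mD)[mrf mif finf] /(L2P _ mD)[mrg mig fing].
have mr : measurable_fun D (reC (fun x => f x + g x)).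
  have -> : reC (fun x => f x + g x) = (fun x => reC f x + reC g x).
    by apply/funext => x; rewrite /reC ReD.
  exact: measurable_funD.
have mi : measurable_fun D (imC (fun x => f x + g x)).
  have -> : imC (fun x => f x + g x) = (fun x => imC f x + imC g x).
    by apply/funext => x; rewrite /imC ImD.
  exact: measurable_funD.
apply/(L2P _ mD); split=> //.
have i2 := integrableZl mD 2 (integrableD mD finf fing).
apply: (le_integrable mD _ _ i2).
  apply/measurable_EFinP; rewrite normc_sqr_fun.
  by apply: measurable_funD; exact: measurable_funX.
move=> x _ /=; rewrite lee_fin ger0_norm ?sqr_ge0// (le_trans _ (ler_norm _))//.
rewrite !normc_sqr !ReImE.
move: (complex.Re (f x)) (complex.Im (f x)) (complex.Re (g x)) (complex.Im (g x)).
move=> a b a' b'; have := sqr_ge0 (a - a'); have := sqr_ge0 (b - b'); nra.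
Qed.

Lemma L2Z D (k : R[i]) f : measurable D -> L2 D f -> L2 D (fun x => k * f x).
Proof.
move=> mD /(L2P _ mD)[mrf mif finf].
apply/(L2P _ mD); split.
- have -> : reC (fun x => k * f x) =
      (fun x => complex.Re k * reC f x - complex.Im k * imC f x).
    by apply/funext => x; rewrite /reC ReM.
  by apply: measurable_funB; apply: measurable_funM.
- have -> : imC (fun x => k * f x) =
      (fun x => complex.Re k * imC f x + complex.Im k * reC f x).
    by apply/funext => x; rewrite /imC ImM.
  by apply: measurable_funD; apply: measurable_funM.
have := integrableZl mD (normc k ^+ 2) finf.
congr (integrable _ _ _); apply/funext => x /=; rewrite -EFinM; congr EFin.
by rewrite !normc_sqr !ReImE; ring.
Qed.

Lemma L2B D f g : measurable D -> L2 D f -> L2 D g -> L2 D (fun x => f x - g x).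
Proof.
move=> mD Lf /(L2Z (-1) mD) Lg; have := L2D mD Lf Lg.
by congr (L2 _ _); apply/funext => x; rewrite mulN1r.
Qed.

(** On a bounded interval, from |f| <= 1 + |f|^2. *)
Lemma L2_integrable (l r : R) f : L2 `]l, r[ f ->
  leb.-integrable `]l, r[ (EFin \o reC f) /\ leb.-integrable `]l, r[ (EFin \o imC f).
Proof.
have mI : measurable (`]l, r[%classic : set (measurableTypeR R)) by exact: measurable_itv.
move=> /(L2P _ mI)[mr mi fin].
have i1 : leb.-integrable `]l, r[ (EFin \o cst 1).
  apply: measurable_bounded_integrable => //.
    rewrite /= lebesgue_measure_itv/=; case: ifP => // _.
    by rewrite -EFinD ltry.
  by exists 1; split; [exact: real1|move=> M M1 x _ /=; rewrite normr1 ltW].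
have i2 := integrableD mI i1 fin.
split; apply: (le_integrable mI _ _ i2);
  try exact/measurable_EFinP.
  move=> x _ /=; rewrite lee_fin (le_trans _ (ler_norm _))// normc_sqr.
  rewrite -[_ ^+ 2](real_normK (num_real _)) /reC.
  by have := sqr_ge0 (complex.Im (f x)); have := sqr_ge0 (`|complex.Re (f x)| - 1); nra.
move=> x _ /=; rewrite lee_fin (le_trans _ (ler_norm _))// normc_sqr.
rewrite -[X in _ + (_ + X)](real_normK (num_real _)) /imC.
by have := sqr_ge0 (complex.Re (f x)); have := sqr_ge0 (`|complex.Im (f x)| - 1); nra.
Qed.

Lemma L2_bounded (l r B : R) f : measurable_fun setT (reC f) ->
  measurable_fun setT (imC f) -> (forall x, normc (f x) ^+ 2 <= B) -> L2 `]l, r[ f.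
Proof.
have mI : measurable (`]l, r[%classic : set (measurableTypeR R)) by exact: measurable_itv.
move=> mr mi fB; apply/(L2P _ mI); split.
- exact: measurable_funTS.
- exact: measurable_funTS.
apply: measurable_bounded_integrable => //.
- rewrite /= lebesgue_measure_itv/=; case: ifP => // _.
  by rewrite -EFinD ltry.
- rewrite normc_sqr_fun.
  by apply: measurable_funD; apply: measurable_funX; exact: measurable_funTS.
- exists B; split; first exact: num_real.
  by move=> M BM x _ /=; rewrite ger0_norm ?sqr_ge0// (le_trans (fB x))// ltW.
Qed.

Lemma primitiveC_L2 C F f (l r : R) : primitiveC C F f -> L2 `]l, r[ F.
Proof.
move=> [pr pi]; have [B1 B1P] := primitive_bounded pr; have [B2 B2P] := primitive_bounded pi.
apply: (@L2_bounded _ _ (B1 ^+ 2 + B2 ^+ 2)).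
- exact: primitive_measurable pr.
- exact: primitive_measurable pi.
move=> x; rewrite normc_sqr lerD//.
  rewrite -real_normK ?num_real// lerXn2r ?nnegrE//; last exact: B1P.
  exact: le_trans (B1P x).
rewrite -real_normK ?num_real// lerXn2r ?nnegrE//; last exact: B2P.
exact: le_trans (B2P x).
Qed.

End SquareIntegrable.

(** * Complex integrals *)

Section ComplexIntegral.
Set Implicit Arguments.
Unset Strict Implicit.
Context {R : realType}.
Notation leb := (@lebesgue_measure R).
Implicit Types (f g : R -> R[i]) (x : R).

Definition summableC f : Prop := summable_fun (reC f) /\ summable_fun (imC f).

Definition cumulC f x : R[i] := cumul (reC f) x +i* cumul (imC f) x.

Lemma cumulC_primitive f : summableC f -> primitiveC 0 (cumulC f) f.
Proof. by move=> [sr si]; split; exact: cumul_primitive. Qed.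

Lemma summableCD f g : summableC f -> summableC g ->
  summableC (fun t => f t + g t).
Proof.
move=> [rf if_] [rg ig]; split.
  by have := summableD rf rg; apply: eq_summable => t; rewrite /reC ReD.
by have := summableD if_ ig; apply: eq_summable => t; rewrite /imC ImD.
Qed.

Lemma summableCZ k f : summableC f -> summableC (fun t => k * f t).
Proof.
move=> [rf if_]; split.
  have := summableB (summableZ (complex.Re k) rf) (summableZ (complex.Im k) if_).
  by apply: eq_summable => t; rewrite /reC ReM.
have := summableD (summableZ (complex.Re k) if_) (summableZ (complex.Im k) rf).
by apply: eq_summable => t; rewrite /imC ImM.
Qed.

Lemma summableC_primitiveM C F dF f : primitiveC C F dF -> summableC f ->
  summableC (fun t => f t * F t).
Proof.
move=> [rF iF] [rf if_]; split.
  have := summableB (summableM_primitive rF rf) (summableM_primitive iF if_).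
  by apply: eq_summable => t; rewrite /reC ReM.
have := summableD (summableM_primitive iF rf) (summableM_primitive rF if_).
by apply: eq_summable => t; rewrite /imC ImM.
Qed.

Let if_patch (P : pred R) (f : R -> R) :
  (fun t => if P t then f t else 0) = f \_ [set` P].
Proof.
by apply/funext => t; rewrite patchE; congr (if _ then _ else _);
   apply/idP/idP; rewrite inE.
Qed.

Let reC_if (P : pred R) f :
  reC (fun t => if P t then f t else 0) = (reC f) \_ [set` P].
Proof. by rewrite -if_patch; apply/funext => t; rewrite /reC; case: ifP. Qed.

Let imC_if (P : pred R) f :
  imC (fun t => if P t then f t else 0) = (imC f) \_ [set` P].
Proof. by rewrite -if_patch; apply/funext => t; rewrite /imC; case: ifP. Qed.

Lemma integralC_window l r f :
  integralC `]l, r[ f = integralC setT (fun t => if t \in `]l, r[ then f t else 0).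
Proof. by rewrite /integralC reC_if imC_if -!Rintegral_mkcond. Qed.

Lemma integrableC_window l r f :
  integrableC `]l, r[ f <-> summableC (fun t => if t \in `]l, r[ then f t else 0).
Proof.
have mI : measurable (`]l, r[%classic : set (measurableTypeR R)) by exact: measurable_itv.
by rewrite /summableC reC_if imC_if /summable_fun -!restrict_EFin -!integrable_mkcond.
Qed.

Lemma summableC_cut x f : summableC f ->
  summableC (fun t => if t <= x then f t else 0).
Proof.
have mI : measurable ([set` (fun t => t <= x)] : set (measurableTypeR R)).
  rewrite (_ : [set` _] = `]-oo, x]%classic); first exact: measurable_itv.
  by rewrite set_itvNyc.
by move=> [rf if_]; split; rewrite ?reC_if ?imC_if;
   apply: summable_patch => //; exact: summable_restrict.
Qed.

Lemma integralC_cut x f :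
  integralC setT (fun t => if t <= x then f t else 0) = cumulC f x.
Proof.
rewrite /integralC reC_if imC_if -!Rintegral_mkcond /cumulC /cumul.
by rewrite set_itvNyc.
Qed.

Lemma integralCD f g : summableC f -> summableC g ->
  integralC setT (fun t => f t + g t) = integralC setT f + integralC setT g.
Proof.
move=> [rf if_] [rg ig]; apply: eq_Re_Im; rewrite ?ReD ?ImD /=.
  by rewrite -RintegralD//; congr (Rintegral _ _ _); apply/funext => t; rewrite /reC ReD.
by rewrite -RintegralD//; congr (Rintegral _ _ _); apply/funext => t; rewrite /imC ImD.
Qed.

Lemma integralCZ k f : summableC f ->
  integralC setT (fun t => k * f t) = k * integralC setT f.
Proof.
move=> [rf if_]; apply: eq_Re_Im; rewrite ?ReM ?ImM /= -!RintegralZl//.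
  rewrite -RintegralB//; [|exact: summableZ..].
  by congr (Rintegral _ _ _); apply/funext => t; rewrite /reC ReM.
rewrite -RintegralD//; [|exact: summableZ..].
by congr (Rintegral _ _ _); apply/funext => t; rewrite /imC ImM.
Qed.

End ComplexIntegral.

(** * A regular Sturm-Liouville problem on one interval *)

Section OpenIntervalProblem.
Set Implicit Arguments.
Unset Strict Implicit.
Context {R : realType}.
Notation leb := (@lebesgue_measure R).
Notation derivC := Defs.derivC.
Variables (l r : R).
Hypothesis lr : l < r.
Implicit Types (f g y p h : R -> R[i]) (x : R).

(** Complex-valued, so that it can multiply densities. *)
Definition window x : R[i] := (if x \in `]l, r[ then 1 else 0)%:C.

Lemma window_in x : x \in `]l, r[ -> window x = 1.
Proof. by rewrite /window => ->. Qed.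

Lemma window_out x : x \notin `]l, r[ -> window x = 0.
Proof. by rewrite /window => /negPf ->. Qed.

Lemma windowE f x : window x * f x = if x \in `]l, r[ then f x else 0.
Proof. by rewrite /window; case: ifP; rewrite ?mul1r ?mul0r. Qed.

Lemma window_left x : x <= l -> window x = 0.
Proof. by move=> xl; rewrite window_out// in_itv/= ltNge xl. Qed.

Lemma window_right x : r <= x -> window x = 0.
Proof. by move=> rx; rewrite window_out// in_itv/= !ltNge rx andbF. Qed.

Lemma L2_summableC f : L2 `]l, r[ f -> summableC (fun x => window x * f x).
Proof.
move=> /L2_integrable Lf; under [X in summableC X]eq_fun do rewrite windowE.
exact/integrableC_window.
Qed.

Lemma windowed_primitive_left C F f :
  primitiveC C F (fun x => window x * f x) -> F l = C.
Proof. by move=> /primitiveC_init; apply => t /window_left ->; rewrite mul0r. Qed.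

Lemma windowed_primitive_derivable C F f D g x :
  primitiveC C F (fun x => window x * f x) -> primitiveC D f g ->
  x \in `]l, r[ -> derivableC F x /\ derivC F x = f x.
Proof.
move=> [rF iF] [rf if_] xlr.
have win : \near x, window x = 1.
  by near=> t; apply: window_in; near: t; exact: near_in_itvoo.
have cr : {for x, continuous (reC (fun x => window x * f x))}.
  have cf := primitive_continuous rf; have := cf x; rewrite /prop_for /continuous_at.
  rewrite (_ : reC (fun x => window x * f x) x = reC f x); last first.
    by rewrite /reC (window_in xlr) mul1r.
  apply: cvg_trans.
  by apply: near_eq_cvg; apply: filterS win => t tE; rewrite /reC tE mul1r.
have ci : {for x, continuous (imC (fun x => window x * f x))}.
  have cf := primitive_continuous if_; have := cf x; rewrite /prop_for /continuous_at.
  rewrite (_ : imC (fun x => window x * f x) x = imC f x); last first.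
    by rewrite /imC (window_in xlr) mul1r.
  apply: cvg_trans.
  by apply: near_eq_cvg; apply: filterS win => t tE; rewrite /imC tE mul1r.
have [dr drE] := primitive_derivable_continuous rF cr.
have [di diE] := primitive_derivable_continuous iF ci.
split; first by split.
rewrite /derivC drE diE /reC /imC (window_in xlr) mul1r.
by case: (f x).
Unshelve. all: by end_near. Qed.

Lemma primitiveC_limC (K : set_system R) C F f x : ProperFilter K ->
  primitiveC C F f -> K --> x -> cvgC K F /\ limC K F = F x.
Proof.
move=> PK pF Kx; have [cr ci] := @primitiveC_cvg _ K C F f x _ pF Kx.
by have [cK ->] := limCP PK cr ci; split=> //; case: (F x).
Qed.

Lemma at_right_cvg x : x^'+ --> x.
Proof. exact: cvg_within. Qed.

Lemma at_left_cvg x : x^'- --> x.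
Proof. exact: cvg_within. Qed.

(** The density of [p] is itself the representative of y'' demanded by the
    problem: [p] has this derivative almost everywhere by Lebesgue's theorem,
    and y' = [p] everywhere because [p] is continuous. With this choice
    ell y = lam y - h identically, so that its square integrability is that
    of y and h. *)
Lemma sl_solution_of_primitives (q : R -> R[i]) lam h C D y p :
  L2 `]l, r[ h ->
  primitiveC C y (fun x => window x * p x) ->
  primitiveC D p (fun x => window x * ((q x - lam) * y x + h x)) ->
  sl_solution q lam h l r y /\
  [/\ limC l^'+ y = y l, limC l^'+ (derivC y) = p l,
      limC r^'- y = y r & limC r^'- (derivC y) = p r].
Proof.
move=> Lh py pp.
have mI : measurable (`]l, r[%classic : set (measurableTypeR R)) by exact: measurable_itv.
have dy x : x \in `]l, r[ -> derivableC y x /\ derivC y x = p x.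
  exact: windowed_primitive_derivable py pp.
have pE : eq_oo l r p (derivC y) by move=> x /dy[].
have [cyl yl] := primitiveC_limC (at_right_proper_filter l) py (@at_right_cvg l).
have [cyr yr] := primitiveC_limC (at_left_proper_filter r) py (@at_left_cvg r).
have [cpl pl] := primitiveC_limC (at_right_proper_filter l) pp (@at_right_cvg l).
have [cpr pr] := primitiveC_limC (at_left_proper_filter r) pp (@at_left_cvg r).
have [cdl dl] := eq_oo_limC_left lr pE cpl.
have [cdr dr] := eq_oo_limC_right lr pE cpr.
split; last by split=> //; [rewrite dl|rewrite dr].
exists (fun x => (q x - lam) * y x + h x); split => //.
- split.
  + by move=> x /dy[].
  + apply: eq_oo_loc_abs_continuous pE _ => u v _ _ _.
    exact: primitiveC_abs_continuous pp.
  + have [rp ip] := pp.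
    apply: filterS2 (primitive_derivable_ae rp) (primitive_derivable_ae ip).
      exact: (ae_filter_ringOfSetsType leb).
    move=> x [drp drpE] [dip dipE] xlr.
    split; first by apply: (eq_oo_derivableC pE xlr); split.
    rewrite -(eq_oo_derivC pE xlr) /derivC drpE dipE /reC /imC.
    by rewrite (window_in xlr) mul1r; case: (_ + _).
- split; first exact: primitiveC_L2 py.
  split; first exact: eq_oo_L2 pE (primitiveC_L2 _ _ pp).
  have := L2B mI (L2Z lam mI (primitiveC_L2 l r py)) Lh.
  by congr (L2 _ _); apply/funext => x; rewrite /ell; ring.
- by apply: aeW => x _; rewrite /ell; ring.
Qed.

Variables (q : R -> R[i]) (lam : R[i]).
Hypothesis Lq : L2 `]l, r[ q.

(** The homogeneous equation as a first order system of integral equations,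
    with initial values [C] and [D] of y and y' at l. *)
Definition homogeneous C D y p : Prop :=
  primitiveC C y (fun x => window x * p x) /\
  primitiveC D p (fun x => window x * ((q x - lam) * y x)).

Lemma homogeneous_exists C D : exists y p, homogeneous C D y p.
Proof.
have mI : measurable (`]l, r[%classic : set (measurableTypeR R)) by exact: measurable_itv.
have sw : summable_fun (fun x => if x \in `]l, r[ then 1 else 0 : R).
  have := integrable_indic_itv l r false true.
  apply: eq_summable => x; rewrite /= indicE.
  by rewrite (_ : (x \in _) = (x \in `]l, r[))//; [case: ifP|apply/idP/idP; rewrite inE].
have Lcst : L2 `]l, r[ (fun=> lam) := primitiveC_L2 l r (primitiveC_cst lam).
have [sr si] := L2_summableC (L2B mI Lq Lcst).
have [y [p [py pp]]] := @second_order_exists _ _ _ C D sw sr si.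
by exists y, p; split=> //; apply: eq_primitiveC pp => x; rewrite mulrA.
Qed.

Lemma homogeneousD C1 D1 y1 p1 C2 D2 y2 p2 (k1 k2 : R[i]) :
  homogeneous C1 D1 y1 p1 -> homogeneous C2 D2 y2 p2 ->
  homogeneous (k1 * C1 + k2 * C2) (k1 * D1 + k2 * D2)
    (fun x => k1 * y1 x + k2 * y2 x) (fun x => k1 * p1 x + k2 * p2 x).
Proof.
move=> [py1 pp1] [py2 pp2]; split.
  have := primitiveCD (primitiveCZ k1 py1) (primitiveCZ k2 py2).
  by apply: eq_primitiveC => x; ring.
have := primitiveCD (primitiveCZ k1 pp1) (primitiveCZ k2 pp2).
by apply: eq_primitiveC => x; ring.
Qed.

(** By the Leibniz rule its density is identically zero. *)
Lemma wronskian_constant C1 D1 u pu C2 D2 v pv :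
  homogeneous C1 D1 u pu -> homogeneous C2 D2 v pv ->
  forall x, u x * pv x - pu x * v x = C1 * D2 - D1 * C2.
Proof.
move=> [yu qu] [yv qv]; apply: primitiveC0_cst.
have := primitiveCB (primitiveCM yu qv) (primitiveCM qu yv).
by apply: eq_primitiveC => x; ring.
Qed.

(** Data at r are reached by combining the two fundamental solutions at l:
    their Wronskian at r is 1, and Cramer's rule gives the coefficients. *)
Lemma homogeneous_exists_right C D :
  exists C0 D0 y p, homogeneous C0 D0 y p /\ y r = C /\ p r = D.
Proof.
have [y1 [p1 h1]] := homogeneous_exists 1 0.
have [y2 [p2 h2]] := homogeneous_exists 0 1.
have W1 := wronskian_constant h1 h2 r; rewrite mulr1 mul0r subr0 in W1.
have hh := homogeneousD (C * p2 r - D * y2 r) (D * y1 r - C * p1 r) h1 h2.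
do 4 eexists; split; [exact: hh|split].
  by rewrite -[RHS]mulr1 -W1; ring.
by rewrite -[RHS]mulr1 -W1; ring.
Qed.

Lemma homogeneous_sl_solution C D y p : homogeneous C D y p ->
  sl_solution q lam (fun=> 0) l r y /\
  [/\ limC l^'+ y = C, limC l^'+ (derivC y) = D,
      limC r^'- y = y r & limC r^'- (derivC y) = p r].
Proof.
move=> [py pp].
have L0 : L2 `]l, r[ (fun=> 0 : R[i]) := primitiveC_L2 l r (primitiveC_cst 0).
rewrite -{1}(windowed_primitive_left py) -{1}(windowed_primitive_left pp).
apply: sl_solution_of_primitives L0 py _.
by apply: eq_primitiveC pp => x; rewrite addr0.
Qed.

Section Green.
Variables (C1 D1 C2 D2 : R[i]) (u pu v pv : R -> R[i]).
Hypothesis hu : homogeneous C1 D1 u pu.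
Hypothesis hv : homogeneous C2 D2 v pv.
Let W := C1 * D2 - D1 * C2.
Hypothesis W0 : W != 0.

Definition green_kernel (x t : R) : R[i] :=
  (if t <= x then u t * v x else u x * v t) / W.

Variable h : R -> R[i].
Hypothesis Lh : L2 `]l, r[ h.

Let fu t := window t * h t * u t.
Let fv t := window t * h t * v t.

Let sfu : summableC fu.
Proof. exact: summableC_primitiveM hu.1 (L2_summableC Lh). Qed.

Let sfv : summableC fv.
Proof. exact: summableC_primitiveM hv.1 (L2_summableC Lh). Qed.

(** The integral of [fv] over [x, +oo[; by the cut-off in [fv] it runs up
    to r only. *)
Let tail x : R[i] := integralC setT fv - cumulC fv x.

Let kernel_split x :
  (fun t => if t \in `]l, r[ then green_kernel x t * h t else 0) =
  (fun t => v x / W * (if t <= x then fu t else 0) +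
     (u x / W * fv t + (- (u x / W)) * (if t <= x then fv t else 0))).
Proof.
apply/funext => t; rewrite -(windowE (fun t => green_kernel x t * h t)) /green_kernel /fu /fv.
by case: ifP => _; ring.
Qed.

Let skernel x : [/\ summableC (fun t => v x / W * (if t <= x then fu t else 0)),
   summableC (fun t => u x / W * fv t) &
   summableC (fun t => (- (u x / W)) * (if t <= x then fv t else 0))].
Proof.
by split; apply: summableCZ => //; exact: summableC_cut.
Qed.

Lemma green_kernel_integrable x :
  integrableC `]l, r[ (fun t => green_kernel x t * h t).
Proof.
have [s1 s2 s3] := skernel x.
apply/integrableC_window; rewrite kernel_split.
by apply: summableCD => //; exact: summableCD.
Qed.

(** The variation of constants form v A + u B, where A integrates u h / W
    up to x and B integrates v h / W from x on. *)
Lemma green_kernel_op x : kernel_op `]l, r[ green_kernel h x =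
  v x * (W^-1 * cumulC fu x) + u x * (W^-1 * tail x).
Proof.
have [s1 s2 s3] := skernel x.
rewrite /kernel_op integralC_window kernel_split.
rewrite integralCD//; last exact: summableCD.
rewrite integralCD// !integralCZ ?integralC_cut//; try exact: summableC_cut.
by rewrite /tail; ring.
Qed.

Let tail_primitive : primitiveC (integralC setT fv) tail (fun t => - fv t).
Proof.
have := primitiveCB (primitiveC_cst (integralC setT fv)) (cumulC_primitive sfv).
by rewrite subr0; apply: eq_primitiveC => t; rewrite sub0r.
Qed.

Let tail_right : tail r = 0.
Proof.
rewrite /tail -integralC_cut (_ : (fun t => if t <= r then fv t else 0) = fv).
  by rewrite subrr.
apply/funext => t; case: ifPn => //; rewrite -ltNge => /ltW rt.
by rewrite /fv window_right// !mul0r.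
Qed.

Let head_left : cumulC fu l = 0.
Proof.
apply: primitiveC_init (cumulC_primitive sfu) _ => t tl.
by rewrite /fu window_left// !mul0r.
Qed.

(** With y = v A + u B, the terms v A' + u B' = v u h / W - u v h / W cancel
    in y', so that y' = v' A + u' B; differentiating again leaves
    (u v' - u' v) h / W = h. At l the coefficient A vanishes and y is a multiple
    of u; at r the coefficient B vanishes and y is a multiple of v. This gives
    the boundary conditions. *)
Lemma green_kernel_solution :
  let g := kernel_op `]l, r[ green_kernel h in
  [/\ sl_solution q lam h l r g,
      g l = limC l^'+ g /\ limC l^'+ g * D1 = limC l^'+ (derivC g) * C1 &
      g r = limC r^'- g /\ limC r^'- g * pv r = limC r^'- (derivC g) * v r].
Proof.
move=> g; have -> : g = (fun x => v x * (W^-1 * cumulC fu x) + u x * (W^-1 * tail x)).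
  by apply/funext => x; exact: green_kernel_op.
pose p x := pv x * (W^-1 * cumulC fu x) + pu x * (W^-1 * tail x).
have [yu qu] := hu; have [yv qv] := hv.
have pA := primitiveCZ W^-1 (cumulC_primitive sfu).
have pB := primitiveCZ W^-1 tail_primitive.
have py := primitiveCD (primitiveCM yv pA) (primitiveCM yu pB).
have pp := primitiveCD (primitiveCM qv pA) (primitiveCM qu pB).
have WE x : (u x * pv x - pu x * v x) / W = 1.
  by rewrite (wronskian_constant hu hv) divff.
have {}py := eq_primitiveC (_ : _ =1 (fun x => window x * p x)) py.
have {}pp := eq_primitiveC (_ : _ =1 (fun x => window x *
  ((q x - lam) * (v x * (W^-1 * cumulC fu x) + u x * (W^-1 * tail x)) + h x))) pp.
have [||slg [-> -> -> ->]] := sl_solution_of_primitives Lh (py _) (pp _).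
- by move=> x; rewrite /p /fu /fv; ring.
- move=> x.
  rewrite -[X in _ = _ * (_ + X)]mulr1 -(WE x) /fu /fv; ring.
split=> //.
  split=> //; rewrite /p head_left (windowed_primitive_left yu).
  by rewrite (windowed_primitive_left qu); ring.
by split=> //; rewrite /p tail_right; ring.
Qed.

End Green.

(** The boundary conditions are y(l) D1 = y'(l) C1 and y(r) D2 = y'(r) C2.
    If the Wronskian of u and v vanished, then u would satisfy the condition
    at r as well as the one at l, hence be trivial by hypothesis, and its
    initial values C1 and D1 would both be zero. *)
Theorem green_kernel_exists (C1 D1 C2 D2 : R[i]) : (C1 != 0) || (D1 != 0) ->
  (forall y, sl_solution q lam (fun=> 0) l r y ->
     limC l^'+ y * D1 = limC l^'+ (derivC y) * C1 ->
     limC r^'- y * D2 = limC r^'- (derivC y) * C2 ->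
     eq_oo l r y (fun=> 0)) ->
  exists K : R -> R -> R[i], forall h, L2 `]l, r[ h ->
    let g := kernel_op `]l, r[ K h in
    [/\ forall x, integrableC `]l, r[ (fun t => K x t * h t),
        sl_solution q lam h l r g,
        g l = limC l^'+ g /\ limC l^'+ g * D1 = limC l^'+ (derivC g) * C1 &
        g r = limC r^'- g /\ limC r^'- g * D2 = limC r^'- (derivC g) * C2].
Proof.
move=> CD0 uniq.
have [u [pu hu]] := homogeneous_exists C1 D1.
have [C0 [D0 [v [pv [hv [vr pvr]]]]]] := homogeneous_exists_right C2 D2.
(* C0 and D0 are the values at l of the solution v with data C2, D2 at r. *)
have W0 : C1 * D0 - D1 * C0 != 0.
  apply/negP => /eqP W0.
  have [slu [ul pul ur pur]] := homogeneous_sl_solution hu.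
  have u0 : eq_oo l r u (fun=> 0).
    apply: uniq => //; first by rewrite ul pul mulrC.
    rewrite ur pur -vr -pvr; apply/eqP; rewrite -subr_eq0.
    by rewrite (wronskian_constant hu hv) W0.
  have z0 := primitiveC_cst (0 : R[i]).
  have [cz lz] := primitiveC_limC (at_right_proper_filter l) z0 (@at_right_cvg l).
  have [_] := eq_oo_limC_left lr (eq_oo_sym u0) cz.
  rewrite ul lz => C10.
  have du0 : eq_oo l r (fun=> 0) (derivC u).
    move=> x xlr; rewrite (eq_oo_derivC u0 xlr) /derivC.
    by rewrite !derive1_cst.
  have [_] := eq_oo_limC_left lr du0 cz.
  by rewrite pul lz => D10; move: CD0; rewrite C10 D10 eqxx.
exists (green_kernel C1 D1 C0 D0 u v) => h Lh g.
have [slg gl gr] := green_kernel_solution hu hv W0 Lh.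
split=> //; last by rewrite -{1}vr -pvr.
by move=> x; exact: (green_kernel_integrable hu hv Lh x).
Qed.

End OpenIntervalProblem.

(** * Differences of solutions and the zero solution *)

Section SolutionAlgebra.
Set Implicit Arguments.
Unset Strict Implicit.
Context {R : realType}.
Notation leb := (@lebesgue_measure R).
Notation derivC := Defs.derivC.
Implicit Types (f g y h : R -> R[i]) (q : R -> R[i]) (l r : R) (lam : R[i]).

Lemma limCB (K : set_system R) f g : ProperFilter K -> cvgC K f -> cvgC K g ->
  cvgC K (fun x => f x - g x) /\ limC K (fun x => f x - g x) = limC K f - limC K g.
Proof.
move=> PK /cvgCP[fr fi] /cvgCP[gr gi].
have -> : limC K f - limC K g =
    (complex.Re (limC K f) - complex.Re (limC K g)) +i*
    (complex.Im (limC K f) - complex.Im (limC K g)) by [].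
apply: limCP.
  rewrite (_ : reC _ = fun x => reC f x - reC g x); first exact: cvgB.
  by apply/funext => x; rewrite /reC !ReImE.
rewrite (_ : imC _ = fun x => imC f x - imC g x); first exact: cvgB.
by apply/funext => x; rewrite /imC !ReImE.
Qed.

Lemma derivableCB f g x : derivableC f x -> derivableC g x ->
  derivableC (fun x => f x - g x) x /\
  derivC (fun x => f x - g x) x = derivC f x - derivC g x.
Proof.
move=> [fr fi] [gr gi].
have rE : reC (fun x => f x - g x) = reC f - reC g.
  by apply/funext => t; rewrite /reC !ReImE.
have iE : imC (fun x => f x - g x) = imC f - imC g.
  by apply/funext => t; rewrite /imC !ReImE.
split; first by split; rewrite ?rE ?iE; exact: derivableB.
apply: eq_Re_Im; rewrite !ReImE /= !derive1E.
  by rewrite rE (deriveB fr gr).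
by rewrite iE (deriveB fi gi).
Qed.

Lemma normcB_le (z w : R[i]) : Normc.normc (z - w) <= Normc.normc z + Normc.normc w.
Proof.
apply: (le_trans (le_normcD _ _)); rewrite lerD2l.
by case: w => a b /=; rewrite !sqrrN.
Qed.

Lemma loc_abs_continuousB l r f g :
  loc_abs_continuous l r f -> loc_abs_continuous l r g ->
  loc_abs_continuous l r (fun x => f x - g x).
Proof.
move=> cf cg u v lu uv vr e e0; have e20 : 0 < e / 2 by rewrite divr_gt0.
have [d1 d10 d1P] := cf u v lu uv vr _ e20.
have [d2 d20 d2P] := cg u v lu uv vr _ e20.
exists (Order.min d1 d2); first by rewrite lt_min d10.
move=> n s t ust disj; rewrite lt_min => /andP[std1 std2].
have := ltrD (d1P n s t ust disj std1) (d2P n s t ust disj std2).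
rewrite -splitr; apply: le_lt_trans; rewrite -big_split/=; apply: ler_sum => i _.
rewrite (_ : _ - _ = f (t i) - f (s i) - (g (t i) - g (s i))); last by ring.
exact: normcB_le.
Qed.

Lemma sl_solution_cvg q lam h l r y : sl_solution q lam h l r y ->
  [/\ cvgC l^'+ y, cvgC l^'+ (derivC y), cvgC r^'- y & cvgC r^'- (derivC y)].
Proof. by move=> [w [_ _ _ [? ?] [? ?]]]. Qed.

Lemma eq_oo_limits q lam h l r y1 y2 : l < r -> eq_oo l r y1 y2 ->
  sl_solution q lam h l r y1 ->
  [/\ limC l^'+ y2 = limC l^'+ y1, limC l^'+ (derivC y2) = limC l^'+ (derivC y1),
      limC r^'- y2 = limC r^'- y1 & limC r^'- (derivC y2) = limC r^'- (derivC y1)].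
Proof.
move=> lr y12 /sl_solution_cvg[cl cpl cr cpr]; have p12 := eq_oo_derivC y12.
split.
- by have [] := eq_oo_limC_left lr y12 cl.
- by have [] := eq_oo_limC_left lr p12 cpl.
- by have [] := eq_oo_limC_right lr y12 cr.
- by have [] := eq_oo_limC_right lr p12 cpr.
Qed.

Lemma sl_solutionB q lam h l r y1 y2 : l < r ->
  sl_solution q lam h l r y1 -> sl_solution q lam h l r y2 ->
  let y := fun x => y1 x - y2 x in
  sl_solution q lam (fun=> 0) l r y /\
  [/\ limC l^'+ y = limC l^'+ y1 - limC l^'+ y2,
      limC l^'+ (derivC y) = limC l^'+ (derivC y1) - limC l^'+ (derivC y2),
      limC r^'- y = limC r^'- y1 - limC r^'- y2 &
      limC r^'- (derivC y) = limC r^'- (derivC y1) - limC r^'- (derivC y2)].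
Proof.
move=> lr [w1 [[dy1 ac1 aew1] [Ly1 [Lp1 Le1]] ae1 [cl1 cpl1] [cr1 cpr1]]].
move=> [w2 [[dy2 ac2 aew2] [Ly2 [Lp2 Le2]] ae2 [cl2 cpl2] [cr2 cpr2]]] y.
have mI : measurable (`]l, r[%classic : set (measurableTypeR R)) by exact: measurable_itv.
have pE : eq_oo l r (fun x => derivC y1 x - derivC y2 x) (derivC y).
  by move=> x xlr; have [_ ->] := derivableCB (dy1 x xlr) (dy2 x xlr).
have [cl ll] := limCB (at_right_proper_filter l) cl1 cl2.
have [cr lr'] := limCB (at_left_proper_filter r) cr1 cr2.
have [cpl lpl] := limCB (at_right_proper_filter l) cpl1 cpl2.
have [cpr lpr] := limCB (at_left_proper_filter r) cpr1 cpr2.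
have [cdl ldl] := eq_oo_limC_left lr pE cpl.
have [cdr ldr] := eq_oo_limC_right lr pE cpr.
split; last by split; [exact: ll|rewrite ldl|exact: lr'|rewrite ldr].
exists (fun x => w1 x - w2 x); split; [| | |exact: (conj cl cdl)|exact: (conj cr cdr)].
- split.
  + by move=> x xlr; have [] := derivableCB (dy1 x xlr) (dy2 x xlr).
  + exact: eq_oo_loc_abs_continuous pE (loc_abs_continuousB ac1 ac2).
  + apply: filterS2 aew1 aew2; first exact: (ae_filter_ringOfSetsType leb).
    move=> x h1 h2 xlr; have [d1 E1] := h1 xlr; have [d2 E2] := h2 xlr.
    have [d dE] := derivableCB d1 d2.
    split; first exact: (eq_oo_derivableC pE xlr d).
    by rewrite -(eq_oo_derivC pE xlr) dE E1 E2.
- split; first exact: (L2B mI Ly1 Ly2).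
  split; first exact: eq_oo_L2 pE (L2B mI Lp1 Lp2).
  have := L2B mI Le1 Le2.
  by congr (L2 _ _); apply/funext => x; rewrite /ell /y; ring.
- apply: filterS2 ae1 ae2; first exact: (ae_filter_ringOfSetsType leb).
  move=> x h1 h2 xlr; rewrite -(subrr (h x)) -{1}(h1 xlr) -(h2 xlr) /ell /y; ring.
Qed.

Lemma sl_solution_zero q lam l r z : l < r -> eq_oo l r (fun=> 0) z ->
  sl_solution q lam (fun=> 0) l r z /\
  [/\ limC l^'+ z = 0, limC l^'+ (derivC z) = 0,
      limC r^'- z = 0 & limC r^'- (derivC z) = 0].
Proof.
move=> lr z0.
have pz := primitiveC_cst (0 : R[i]).
have L0 : L2 `]l, r[ (fun=> 0 : R[i]) := primitiveC_L2 l r pz.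
have E1 : (fun=> 0) =1 (fun x => window l r x * (0 : R[i])).
  by move=> x; rewrite mulr0.
have E2 : (fun=> 0) =1 (fun x => window l r x * ((q x - lam) * 0 + 0 : R[i])).
  by move=> x; rewrite mulr0 addr0 mulr0.
have [sl0 [l1 l2 l3 l4]] := sl_solution_of_primitives lr L0 (eq_primitiveC E1 pz) (eq_primitiveC E2 pz).
split; first exact: (eq_oo_sl_solution lr z0 _ sl0).
by have [-> -> -> ->] := eq_oo_limits lr z0 sl0.
Qed.

End SolutionAlgebra.

(** * The two one-sided problems and their Green's functions *)

Section DecoupledProblem.
Set Implicit Arguments.
Unset Strict Implicit.
Context {R : realType}.
Notation derivC := Defs.derivC.
Variables (a b : R) (q : R -> R[i]) (alpha beta : R) (m n : R[i] -> R[i]) (lam : R[i]).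
Hypothesis a0 : 0 < a.
Hypothesis b0 : 0 < b.
Hypothesis Lq : L2 `]- a, b[ q.
Hypothesis pole : is_pole m lam \/ is_pole n lam.
Hypothesis noeig : ~ eigenvalue_P q a b alpha beta m n lam.

Let Na0 : - a < 0. Proof. by rewrite oppr_lt0. Qed.

Let L2_left h : L2 `]- a, b[ h -> L2 `]- a, 0[ h.
Proof.
apply: L2S; try exact: measurable_itv.
by move=> x /=; rewrite !in_itv/= => /andP[-> /lt_trans]; apply.
Qed.

Let L2_right h : L2 `]- a, b[ h -> L2 `]0, b[ h.
Proof.
apply: L2S; try exact: measurable_itv.
by move=> x /=; rewrite !in_itv/= => /andP[/(lt_trans Na0) -> ->].
Qed.

Let solves_left y :=
  [/\ sl_solution q lam (fun=> 0) (- a) 0 y,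
      limC (- a)^'+ y * (cos alpha)%:C = limC (- a)^'+ (derivC y) * (sin alpha)%:C,
      is_pole n lam -> limC 0^'- (derivC y) = 0 &
      ~ is_pole n lam -> limC 0^'- (derivC y) * n lam = - limC 0^'- y].

Let solves_right y :=
  [/\ sl_solution q lam (fun=> 0) 0 b y,
      limC b^'- y * (cos beta)%:C = limC b^'- (derivC y) * (sin beta)%:C,
      is_pole m lam -> limC 0^'+ y = 0 &
      ~ is_pole m lam -> limC 0^'+ y * m lam = limC 0^'+ (derivC y)].

(** Separates the four one-sided limits from the function that they are
    limits of, so that the conditions can be checked on numbers. *)
Lemma transmission_values y (yr pr yl pl : R[i]) :
  limC 0^'+ y = yr -> limC 0^'+ (derivC y) = pr ->
  limC 0^'- y = yl -> limC 0^'- (derivC y) = pl ->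
  (is_pole m lam -> yr = 0) -> (~ is_pole m lam -> yr * m lam = pr - pl) ->
  (is_pole n lam -> pl = 0) -> (~ is_pole n lam -> pl * n lam = yr - yl) ->
  transmission m n lam y.
Proof. by move=> <- <- <- <-. Qed.

Let jump_dirichlet (y p p' k : R[i]) : y * k = p -> p' = 0 -> y * k = p - p'.
Proof. by move=> -> ->; rewrite subr0. Qed.

Let jump_robin (p y y' k : R[i]) : p * k = - y' -> y = 0 -> p * k = y - y'.
Proof. by move=> -> ->; rewrite sub0r. Qed.

(** The extension of [y] by zero to the right of 0 satisfies both
    transmission conditions. The one on Delta' y requires y'(0-) = 0 when lam is
    not a pole of mu; then lam is a pole of nu, and this is the condition of
    the left problem at 0. *)
Lemma left_problem_trivial y : solves_left y -> eq_oo (- a) 0 y (fun=> 0).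
Proof.
move=> [sly bc np nn] x xl; apply: contrapT => yx0; apply: noeig.
(* The value at - a is the limit, as required by the boundary condition there. *)
pose z t : R[i] := if t <= - a then limC (- a)^'+ y else if t < 0 then y t else 0.
have yz : eq_oo (- a) 0 y z.
  by move=> t; rewrite in_itv/= /z => /andP[at_ ->]; rewrite leNgt at_.
have z0 : eq_oo 0 b (fun=> 0) z.
  move=> t; rewrite in_itv/= /z => /andP[t0 _].
  by rewrite leNgt (lt_trans Na0 t0)/= ltNge (ltW t0).
have [slz [zl pzl zr pzr]] := sl_solution_zero q lam b0 z0.
have [yl pyl yr pyr] := eq_oo_limits Na0 yz sly.
exists z; split; last by exists x; split; [left|rewrite -(yz x xl)].
split.
- exact: eq_oo_sl_solution Na0 yz (fun _ _ => erefl) sly.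
- exact: slz.
- have za : z (- a) = limC (- a)^'+ y by rewrite /z lexx.
  rewrite /bc_left za yl pyl; split; [exact: erefl|exact: bc].
- have zb : z b = 0.
    by rewrite /z leNgt (lt_trans Na0 b0)/= ltNge (ltW b0).
  rewrite /bc_right zb zr pzr !mul0r; split; exact: erefl.
apply: (transmission_values zl pzl yr pyr) => [//|mn|//|nn'].
- by case: pole => [/mn[]|/np ->]; rewrite mul0r subrr.
- exact: jump_robin (nn nn') erefl.
Qed.

(** Symmetrically, the extension of [y] by zero to the left of 0 requires
    y(0+) = 0 when lam is not a pole of nu, which is the condition of the right
    problem at a pole of mu. *)
Lemma right_problem_trivial y : solves_right y -> eq_oo 0 b y (fun=> 0).
Proof.
move=> [sly bc mp mn] x xl; apply: contrapT => yx0; apply: noeig.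
(* The value at b is the limit, as required by the boundary condition there. *)
pose z t : R[i] := if b <= t then limC b^'- y else if 0 < t then y t else 0.
have yz : eq_oo 0 b y z.
  by move=> t; rewrite in_itv/= /z => /andP[-> tb]; rewrite leNgt tb.
have z0 : eq_oo (- a) 0 (fun=> 0) z.
  move=> t; rewrite in_itv/= /z => /andP[_ t0].
  by rewrite leNgt (lt_trans t0 b0)/= ltNge (ltW t0).
have [slz [zl pzl zr pzr]] := sl_solution_zero q lam Na0 z0.
have [yl pyl yr pyr] := eq_oo_limits b0 yz sly.
exists z; split; last by exists x; split; [right|rewrite -(yz x xl)].
split.
- exact: slz.
- exact: eq_oo_sl_solution b0 yz (fun _ _ => erefl) sly.
- have za : z (- a) = 0.
    by rewrite /z leNgt (lt_trans Na0 b0)/= ltNge (ltW Na0).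
  rewrite /bc_left za zl pzl !mul0r; split; exact: erefl.
- have zb : z b = limC b^'- y by rewrite /z lexx.
  rewrite /bc_right zb yr pyr; split; [exact: erefl|exact: bc].
apply: (transmission_values yl pyl zr pzr) => [//|nm|//|nn].
- exact: jump_dirichlet (mn nm) erefl.
- by case: pole => [/mp ->|/nn[]]; rewrite mul0r subrr.
Qed.

Let robin_diff (p y p1 y1 p2 y2 k : R[i]) : p = p1 - p2 -> y = y1 - y2 ->
  p1 * k = - y1 -> p2 * k = - y2 -> p * k = - y.
Proof. by move=> -> -> e1 e2; rewrite mulrBl e1 e2 opprB opprK addrC. Qed.

Let dirichlet_diff (y p y1 p1 y2 p2 k : R[i]) : y = y1 - y2 -> p = p1 - p2 ->
  y1 * k = p1 -> y2 * k = p2 -> y * k = p.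
Proof. by move=> -> -> e1 e2; rewrite mulrBl e1 e2. Qed.

Let sin_cos_neq0 (t : R) : ((sin t)%:C != 0 :> R[i]) || ((cos t)%:C != 0 :> R[i]).
Proof.
rewrite -negb_and; apply/negP => /andP[/eqP[s0] /eqP[c0]].
by have := cos2Dsin2 t; rewrite s0 c0 expr0n addr0 => /esym/eqP; rewrite oner_eq0.
Qed.

(** The condition at 0 has the form y(0-) D2 = y'(0-) C2 in either case. The
    kernel reproduces every solution because the difference of two solutions
    solves the homogeneous problem. *)
Lemma green_minus_exists : exists K, green_minus q a alpha n lam K.
Proof.
have Lql := L2_left Lq.
(* At a pole of nu: y'(0-) = 0; otherwise - y(0-) = y'(0-) nu(lam). *)
pose C2 : R[i] := if `[< is_pole n lam >] then 1 else n lam.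
pose D2 : R[i] := if `[< is_pole n lam >] then 0 else - 1.
have bcE (f g : R[i]) : f * D2 = g * C2 <->
    ((is_pole n lam -> g = 0) /\ (~ is_pole n lam -> g * n lam = - f)).
  rewrite /C2 /D2; case: asboolP => pn.
    rewrite mulr0 mulr1; split=> [<-//|[-> //]].
  by rewrite mulrN1; split=> [->//|[_ ->]].
have uniq y : sl_solution q lam (fun=> 0) (- a) 0 y ->
    limC (- a)^'+ y * (cos alpha)%:C = limC (- a)^'+ (derivC y) * (sin alpha)%:C ->
    limC 0^'- y * D2 = limC 0^'- (derivC y) * C2 -> eq_oo (- a) 0 y (fun=> 0).
  by move=> sly bc /bcE[np nn]; exact: left_problem_trivial.
have [K KP] := green_kernel_exists Na0 Lql (sin_cos_neq0 alpha) uniq.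
exists K => h Lh; have [intK slK [Ka bca] [K0 /bcE[np nn]]] := KP h Lh.
split; first by move=> x _; exact: intK.
  split; [exact: slK|split; first exact: Ka|exact: np|exact: nn].
  by rewrite Ka.
move=> y [sly [ya bcy] npy nny].
have [slD [Dl pDl Dr pDr]] := sl_solutionB Na0 sly slK.
have D0 : eq_oo (- a) 0 (fun x => y x - kernel_op `]- a, 0[ K h x) (fun=> 0).
  apply: left_problem_trivial; split; first exact: slD.
  - by rewrite Dl pDl !mulrBl bca -ya bcy.
  - by move=> pn; rewrite pDr (npy pn) (np pn) subrr.
  - by move=> pn; apply: robin_diff pDr Dr (nny pn) (nn pn).
have [_ [lD _ _ _]] := sl_solution_zero q lam Na0 (eq_oo_sym D0).
(* At x = - a both sides equal their limits, and the limits agree. *)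
move=> x; rewrite in_itv/= le_eqVlt => /andP[/predU1P[<- _|ax x0]]; last first.
  by apply/eqP; rewrite -subr_eq0; apply/eqP/D0; rewrite in_itv/= ax.
by apply/eqP; rewrite ya Ka -subr_eq0 -Dl lD.
Qed.

Lemma green_plus_exists : exists K, green_plus q b beta m lam K.
Proof.
have Lqr := L2_right Lq.
(* At a pole of mu: y(0+) = 0; otherwise y(0+) mu(lam) = y'(0+). *)
pose C1 : R[i] := if `[< is_pole m lam >] then 0 else 1.
pose D1 : R[i] := if `[< is_pole m lam >] then 1 else m lam.
have CD0 : (C1 != 0) || (D1 != 0).
  by rewrite /C1 /D1; case: asboolP; rewrite oner_eq0 ?orbT.
have bcE (f g : R[i]) : f * D1 = g * C1 <->
    ((is_pole m lam -> f = 0) /\ (~ is_pole m lam -> f * m lam = g)).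
  rewrite /C1 /D1; case: asboolP => pm.
    by rewrite mulr0 mulr1; split=> [->//|[-> //]].
  by rewrite mulr1; split=> [->//|[_ ->]].
have uniq y : sl_solution q lam (fun=> 0) 0 b y ->
    limC 0^'+ y * D1 = limC 0^'+ (derivC y) * C1 ->
    limC b^'- y * (cos beta)%:C = limC b^'- (derivC y) * (sin beta)%:C ->
    eq_oo 0 b y (fun=> 0).
  by move=> sly /bcE[mp mn] bc; exact: right_problem_trivial.
have [K KP] := green_kernel_exists b0 Lqr CD0 uniq.
exists K => h Lh; have [intK slK [K0 /bcE[mp mn]] [Kb bcb]] := KP h Lh.
split; first by move=> x _; exact: intK.
  split; [exact: slK|split; first exact: Kb|exact: mp|exact: mn].
  by rewrite Kb.
move=> y [sly [yb bcy] mpy mny].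
have [slD [Dl pDl Dr pDr]] := sl_solutionB b0 sly slK.
have D0 : eq_oo 0 b (fun x => y x - kernel_op `]0, b[ K h x) (fun=> 0).
  apply: right_problem_trivial; split; first exact: slD.
  - by rewrite Dr pDr !mulrBl bcb -yb bcy.
  - by move=> pm; rewrite Dl (mpy pm) (mp pm) subrr.
  - by move=> pm; apply: dirichlet_diff Dl pDl (mny pm) (mn pm).
have [_ [_ _ lD _]] := sl_solution_zero q lam b0 (eq_oo_sym D0).
(* At x = b both sides equal their limits, and the limits agree. *)
move=> x; rewrite in_itv/= [x <= b]le_eqVlt => /andP[x0 /predU1P[->|xb]]; last first.
  by apply/eqP; rewrite -subr_eq0; apply/eqP/D0; rewrite in_itv/= x0.
by apply/eqP; rewrite yb Kb -subr_eq0 -Dr lD.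
Qed.

Section Block.
Variables (gm gp : R -> R -> R[i]).
Let G := green_P a b gm gp.

(** For x on the left, only t on the left contributes: at t = 0 the kernel
    takes the value 0, because 0 lies in neither block. *)
Lemma green_P_left x h : x \in `[- a, 0[ ->
  (fun t => if t \in `]- a, b[ then G x t * h t else 0) =
  (fun t => if t \in `]- a, 0[ then gm x t * h t else 0).
Proof.
move=> xl; apply/funext => t; rewrite /G /green_P xl/=.
have -> : (x \in `]0, b]) = false.
  by move: xl; rewrite !in_itv/= => /andP[_ x0]; rewrite ltNge (ltW x0).
rewrite !in_itv/=; have [at_|ta] /= := ltP (- a) t; last by [].
rewrite (ltW at_)/=; have [t0|t0] /= := ltP t 0; first by rewrite (lt_trans t0 b0).
by rewrite mul0r if_same.
Qed.

Lemma green_P_right x h : x \in `]0, b] ->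
  (fun t => if t \in `]- a, b[ then G x t * h t else 0) =
  (fun t => if t \in `]0, b[ then gp x t * h t else 0).
Proof.
move=> xr; apply/funext => t; rewrite /G /green_P xr/=.
have -> : (x \in `[- a, 0[) = false.
  by move: xr; rewrite !in_itv/= => /andP[x0 _]; rewrite [x < 0]ltNge (ltW x0) andbF.
rewrite !in_itv/=; have [tb|bt] /= := ltP t b; last by rewrite !andbF.
rewrite (ltW tb) !andbT; have [t0|t0] /= := ltP 0 t; first by rewrite (lt_trans Na0 t0).
by rewrite mul0r if_same.
Qed.

Hypothesis gmP : green_minus q a alpha n lam gm.
Hypothesis gpP : green_plus q b beta m lam gp.

(** On each side the function is the one given by the one-sided Green's
    function. Where (P) prescribes a jump at 0 by means of mu, lam is a pole of
    nu and the limit of y' from the left vanishes; where it does so by means of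
    nu, lam is a pole of mu and the limit of y from the right vanishes. *)
Lemma green_P_solution h : L2 `]- a, b[ h ->
  (forall x, (x \in `[- a, 0[) \/ (x \in `]0, b]) ->
     integrableC `]- a, b[ (fun t => G x t * h t)) /\
  solution_P q a b alpha beta m n lam h
    (fun x => integralC `]- a, b[ (fun t => G x t * h t)).
Proof.
move=> Lh.
have [intm [slm [ma bca] npm nnm] _] := gmP (L2_left Lh).
have [intp [slp [pb bcb] mpp mnp] _] := gpP (L2_right Lh).
split.
  move=> x [xl|xr]; apply/integrableC_window.
    by rewrite green_P_left//; apply/integrableC_window; exact: intm.
  by rewrite green_P_right//; apply/integrableC_window; exact: intp.
set g := (fun x => integralC _ _).
have gl x : x \in `[- a, 0[ -> kernel_op `]- a, 0[ gm h x = g x.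
  by move=> xl; rewrite /g /kernel_op !integralC_window green_P_left.
have gr x : x \in `]0, b] -> kernel_op `]0, b[ gp h x = g x.
  by move=> xr; rewrite /g /kernel_op !integralC_window green_P_right.
have gl' : eq_oo (- a) 0 (kernel_op `]- a, 0[ gm h) g.
  by move=> x; rewrite in_itv/= => /andP[ax x0]; apply: gl; rewrite in_itv/= ltW.
have gr' : eq_oo 0 b (kernel_op `]0, b[ gp h) g.
  by move=> x; rewrite in_itv/= => /andP[x0 xb]; apply: gr; rewrite in_itv/= x0 ltW.
have [yl pyl yr pyr] := eq_oo_limits Na0 gl' slm.
have [zl pzl zr pzr] := eq_oo_limits b0 gr' slp.
split.
- exact: eq_oo_sl_solution Na0 gl' (fun _ _ => erefl) slm.
- exact: eq_oo_sl_solution b0 gr' (fun _ _ => erefl) slp.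
- have la : - a \in `[- a, 0[ by rewrite in_itv/= lexx Na0.
  rewrite /bc_left -(gl _ la) yl pyl; split; [exact: ma|exact: bca].
- have rb : b \in `]0, b] by rewrite in_itv/= lexx b0.
  rewrite /bc_right -(gr _ rb) zr pzr; split; [exact: pb|exact: bcb].
apply: (transmission_values zl pzl yr pyr) => [//|nm|//|nn].
- by case: pole => [/nm[]|/npm]; exact: jump_dirichlet (mnp nm).
- by case: pole => [/mpp|/nn[]]; exact: jump_robin (nnm nn).
Qed.

End Block.
End DecoupledProblem.

(** * Green's function of the problem at a pole *)

Theorem theorem3p2 (R : realType) (a b : R) (q : R -> R[i]) (alpha beta : R)
    (N M : nat) (eta kappa xi zeta : R)
    (c bb : 'I_N -> R) (d aa : 'I_M -> R) (lam : R[i]) :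
  0 < a -> 0 < b ->
  L2 `]- a, b[ q ->
  0 <= alpha < pi -> 0 < beta <= pi ->
  0 <= eta -> 0 <= kappa ->
  (forall i j : 'I_N, (i < j)%N -> c i < c j) ->
  (forall i j : 'I_M, (i < j)%N -> d i < d j) ->
  (forall i : 'I_N, 0 < bb i) ->
  (forall j : 'I_M, 0 < aa j) ->
  let m := mu eta xi bb c in
  let n := nu kappa zeta aa d in
  is_pole m lam \/ is_pole n lam ->
  ~ eigenvalue_P q a b alpha beta m n lam ->
  [/\ exists gm, green_minus q a alpha n lam gm,
      exists gp, green_plus q b beta m lam gp &
      forall gm gp,
        green_minus q a alpha n lam gm ->
        green_plus q b beta m lam gp ->
        let G := green_P a b gm gp in
        forall h : R -> R[i], L2 `]- a, b[ h ->
          (forall x, (x \in `[- a, 0[) \/ (x \in `]0, b]) ->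
             integrableC `]- a, b[ (fun t => G x t * h t)) /\
          solution_P q a b alpha beta m n lam h
            (fun x => integralC `]- a, b[ (fun t => G x t * h t))].
Proof.
move=> a0 b0 Lq _ _ _ _ _ _ _ _ m n pole noeig; split.
- exact: green_minus_exists a0 b0 Lq pole noeig.
- exact: green_plus_exists a0 b0 Lq pole noeig.
- move=> gm gp gmP gpP G h Lh.
  exact (green_P_solution a0 b0 pole gmP gpP Lh).
Qed.
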